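(* Let $M$ be a stealthy weakly stationary random measure on $\mathbb{R}^d$. Then for every closed strictly convex cone $B\subset\mathbb{R}^d$, $M$ is linearly maximally rigid on $B$.
   Context: For $B\subset\mathbb{R}^d$, $\mathcal{C}_c^b(B)$ is the class of bounded measurable functions on $\mathbb{R}^d$ with bounded support, supported in $B$. A weakly stationary random measure $M$ on $\mathbb{R}^d$ is a collection of complex square integrable random variables $M(f)$, $f\in\mathcal{C}_c^b(\mathbb{R}^d)$, on a probability space $(\Omega,\mathbf{P})$ such that (i) $M$ a.s. induces a complex-valued measure on each compact set, and (ii) $\mathrm{Var}(M(\tau_x f))=\mathrm{Var}(M(f))$ for every translation $\tau_x$, $x\in\mathbb{R}^d$. Its spectral measure $S$ is the non-negative symmetric measure on $\mathbb{R}^d$ such that $\mathrm{Var}(M(f))=(2\pi)^{-d}\int_{\mathbb{R}^d}|\hat f|^2\,dS$ for all $f\in\mathcal{C}_c^b(\mathbb{R}^d)$, where $\hat f(u)=\int_{\mathbb{R}^d}e^{-iu\cdot x}f(x)\,dx$; it satisfies $\int(1+\|u\|)^{-d-1}S(du)<\infty$. $M$ is stealthy if the support of $S$ is not all of $\mathbb{R}^d$, i.e. $S(O)=0$ for some non-empty open set $O\subset\mathbb{R}^d$ (a spectral gap). $M$ is linearly maximally rigid on $B$ if for every $f\in\mathcal{C}_c^b(B)$ there are $h_n\in\mathcal{C}_c^b(B^c)$, $n\ge1$, such that $M(h_n)\to M(f)$ in $L^2(\mathbf{P})$. A closed strictly convex cone is a closed convex cone $B$ not containing both $x$ and $-x$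 for any $x\neq0$.
   Formalization: Weak stationarity here also requires E M(τ_x f) = E M(f); with the variance condition alone the claim fails for a nonzero deterministic finite measure carried by B (variance 0, S = 0). The dimension is d ≥ 1. *)

(* Defs.v *)
From HB Require Import structures.
From mathcomp Require Import all_boot all_order all_algebra.
From mathcomp Require Import complex.
From mathcomp Require Import all_classical all_reals all_analysis.

Set Implicit Arguments.
Unset Strict Implicit.
Unset Printing Implicit Defensive.
Import Order.TTheory GRing.Theory Num.Theory.
Import numFieldNormedType.Exports.

Local Open Scope classical_set_scope.
Local Open Scope ring_scope.

(* Borel sigma-algebra on R^n = 'rV[R]_n. *)
HB.instance Definition _ (R : realType) (n : nat) :=
  @isMeasurable.Build (sigma_display (@open 'rV[R]_n)) 'rV[R]_n
    <<s @open 'rV[R]_n >>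
    (@sigma_algebra0 _ setT _) (@sigma_algebraC _ _) (@sigma_algebra_bigcup _ setT _).

Section borel_rV.
Context {R : realType}.

Lemma open_measurable_rV n (A : set 'rV[R]_n) : open A -> measurable A.
Proof. exact: sub_sigma_algebra. Qed.

Let box n (q : 'rV[rat]_n * 'rV[rat]_n) : set 'rV[R]_n :=
  [set x : 'rV[R]_n | forall i, ratr (q.1 ord0 i) < x ord0 i < ratr (q.2 ord0 i)].

Lemma measurable_fun_rV d (T : measurableType d) n (f : T -> 'rV[R]_n) :
  (forall i, measurable_fun setT (fun t => f t ord0 i : R)) ->
  measurable_fun setT f.
Proof.
move=> mf.
apply: (@measurability _ _ _ _ setT f (@open 'rV[R]_n)) => //.
move=> _ [A oA <-]; rewrite setTI.
have -> : f @^-1` A =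
    \bigcup_q (if `[< @box n q `<=` A >] then f @^-1` (@box n q) else set0).
  apply/seteqP; split=> [t /= Aft|t [q _]]; last first.
    by case: asboolP => //= qA /qA.
  have := oA; rewrite openE => /(_ _ Aft) [P /= nP PA].
  have {}nP i : exists q : rat * rat,
      (ratr q.1 < f t ord0 i < ratr q.2) /\
      (forall y : R, ratr q.1 < y < ratr q.2 -> P ord0 i y).
    have /nbhs_ballP[e /= e0 eP] := nP ord0 i.
    have [a /andP[a1 a2]] : exists a : rat, f t ord0 i - e < ratr a < f t ord0 i.
      have /rat_in_itvoo[a] : f t ord0 i - e < f t ord0 i by rewrite ltrBlDr ltrDl.
      by rewrite in_itv /= => ?; exists a.
    have [b /andP[b1 b2]] : exists b : rat, f t ord0 i < ratr b < f t ord0 i + e.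
      have /rat_in_itvoo[b] : f t ord0 i < f t ord0 i + e by rewrite ltrDl.
      by rewrite in_itv /= => ?; exists b.
    exists (a, b); split; first by rewrite /= a2 b1.
    move=> y /= /andP[ay yb]; apply: eP; rewrite /ball /= ltr_distlC.
    by rewrite (lt_trans a1 ay) (lt_trans yb b2).
  have /choice[g gP] := nP.
  exists (\row_i (g i).1, \row_i (g i).2) => //=.
  rewrite ifT.
    by move=> i /=; rewrite !mxE; exact: (gP i).1.
  apply/asboolP => x xb; apply: PA => i j; rewrite ord1.
  by apply: (gP j).2; have := xb j; rewrite /= !mxE.
apply: countable_bigcupT_measurable => [|q]; first exact: countableP.
case: ifPn => // _.
have -> : f @^-1` (@box n q) = \big[setI/setT]_(i < n)
    ((fun t => f t ord0 i : R) @^-1` `]ratr (q.1 ord0 i), ratr (q.2 ord0 i)[%classic).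
  rewrite -bigcap_seq; apply/seteqP; split => [t /= tb i _ /=|t /= tb i].
    by rewrite in_itv /=; exact: tb.
  by have := tb i (mem_index_enum _); rewrite /= in_itv.
apply: bigsetI_measurable => i _.
by rewrite -[X in measurable X]setTI; apply: mf.
Qed.

Lemma measurable_coord_rV n (i : 'I_n) :
  measurable_fun setT (fun x : 'rV[R]_n => x ord0 i : R).
Proof.
apply: (measurability _ (measurable_realfun.RGenOpens.measurableE R)).
move=> _ [_ [a [b ->]] <-]; rewrite setTI.
apply: open_measurable_rV; apply: open_comp => [x _|]; last exact: interval_open.
exact: coord_continuous.
Qed.

Definition cons_rV n (p : R * 'rV[R]_n) : 'rV[R]_n.+1 :=
  \row_i (if unlift ord0 i is Some j then p.2 ord0 j else p.1).

Lemma cons_rV0 n (p : R * 'rV[R]_n) : cons_rV p ord0 ord0 = p.1.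
Proof. by rewrite mxE unlift_none. Qed.

Lemma cons_rVS n (p : R * 'rV[R]_n) j :
  cons_rV p ord0 (lift ord0 j) = p.2 ord0 j.
Proof. by rewrite mxE liftK. Qed.

Lemma measurable_cons_rV n : measurable_fun setT (@cons_rV n).
Proof.
apply: measurable_fun_rV => i; case: (unliftP ord0 i) => [j|] ->.
  under eq_fun do rewrite cons_rVS.
  exact: (measurableT_comp (measurable_coord_rV j)).
under eq_fun do rewrite cons_rV0.
exact: measurable_fst.
Qed.

End borel_rV.

Section cons_measure.
Local Open Scope ereal_scope.
Context {R : realType} (n : nat).
Variable mu : {sigma_finite_measure set 'rV[R]_n -> \bar R}.

Definition cons_measure : set 'rV[R]_n.+1 -> \bar R :=
  pushforward (@lebesgue_measure R \x mu) (@cons_rV R n).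

Let cons_measure0 : cons_measure set0 = 0.
Proof. by rewrite /cons_measure /pushforward preimage_set0 measure0. Qed.

Let cons_measure_ge0 A : 0 <= cons_measure A.
Proof. rewrite /cons_measure /pushforward; exact: measure_ge0. Qed.

Let measurable_preimage_cons A : measurable A -> measurable (@cons_rV R n @^-1` A).
Proof.
by move=> mA; rewrite -[X in measurable X]setTI; exact: measurable_cons_rV.
Qed.

Let cons_measure_sigma_additive : semi_sigma_additive cons_measure.
Proof.
move=> F mF tF mUF; rewrite /cons_measure /pushforward preimage_bigcup.
apply: measure_semi_sigma_additive.
- by move=> k; exact: measurable_preimage_cons.
- apply/trivIsetP => /= i j _ _ ij; rewrite -preimage_setI.
  by move/trivIsetP : tF => /(_ _ _ _ _ ij) ->//; rewrite preimage_set0.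
- by rewrite -preimage_bigcup; exact: measurable_preimage_cons.
Qed.

HB.instance Definition _ := isMeasure.Build _ _ _ cons_measure
  cons_measure0 cons_measure_ge0 cons_measure_sigma_additive.

Let tail (x : 'rV[R]_n.+1) : 'rV[R]_n := \row_i x ord0 (lift ord0 i).

Let measurable_tail : measurable_fun setT tail.
Proof.
apply: measurable_fun_rV => i; under eq_fun do rewrite mxE.
exact: measurable_coord_rV.
Qed.

Let tailK p : tail (cons_rV p) = p.2.
Proof. by apply/rowP => i; rewrite mxE cons_rVS. Qed.

Lemma cons_measure_setX (A : set R) (B : set 'rV[R]_n) :
  measurable A -> measurable B ->
  cons_measure [set x : 'rV[R]_n.+1 | A (x ord0 ord0) /\ B (\row_i x ord0 (lift ord0 i))] =
  lebesgue_measure A * mu B.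
Proof.
move=> mA mB; rewrite -product_measure1E//; congr (product_measure1 _ _ _).
by apply/seteqP; split=> p /=; rewrite -/(tail _) tailK cons_rV0.
Qed.

Let cons_measure_sigma_finite : sigma_finite setT cons_measure.
Proof.
have /sigma_finiteP[F [TF ndF Foo]] := sigma_finiteT (@lebesgue_measure R).
have /sigma_finiteP[G [TG ndG Goo]] := sigma_finiteT mu.
exists (fun k => [set x : 'rV[R]_n.+1 | F k (x ord0 ord0) /\ G k (tail x)]).
  apply/esym/seteqP; split=> // x _.
  have [k _ Fk] : (\bigcup_k F k) (x ord0 ord0) by rewrite -TF.
  have [l _ Gl] : (\bigcup_k G k) (tail x) by rewrite -TG.
  exists (maxn k l) => //; split.
    by move: Fk; exact/subsetPset/ndF/leq_maxl.
  by move: Gl; exact/subsetPset/ndG/leq_maxr.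
move=> k; have [mF Fk] := Foo k; have [mG Gk] := Goo k; split.
  apply: measurableI.
    by rewrite -[X in measurable X]setTI; exact: measurable_coord_rV.
  by rewrite -[X in measurable X]setTI; exact: measurable_tail.
by rewrite cons_measure_setX// lte_mul_pinfty// ge0_fin_numE.
Qed.

HB.instance Definition _ := Measure_isSigmaFinite.Build _ _ _ cons_measure
  cons_measure_sigma_finite.

End cons_measure.

Fixpoint lebesgue_rV (R : realType) (n : nat) :
    {sigma_finite_measure set 'rV[R]_n -> \bar R} :=
  if n is m.+1 then cons_measure (lebesgue_rV R m) else dirac (0 : 'rV[R]_0).

Lemma lebesgue_rV_box (R : realType) (n : nat) (a b : 'rV[R]_n) :
  (forall i, a ord0 i <= b ord0 i) ->
  lebesgue_rV R n [set x : 'rV[R]_n | forall i, a ord0 i <= x ord0 i <= b ord0 i] =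
  (\prod_i (b ord0 i - a ord0 i))%:E.
Proof.
elim: n => [|n ih] in a b *; move=> ab.
  rewrite big_ord0 /= diracE mem_set//= => -[].
  by [].
pose t (c : 'rV[R]_n.+1) : 'rV[R]_n := \row_i c ord0 (lift ord0 i).
have -> : [set x : 'rV[R]_n.+1 | forall i, a ord0 i <= x ord0 i <= b ord0 i] =
   [set x : 'rV[R]_n.+1 | `[a ord0 ord0, b ord0 ord0]%classic (x ord0 ord0) /\
     [set y : 'rV[R]_n | forall i, t a ord0 i <= y ord0 i <= t b ord0 i] (t x)].
  apply/seteqP; split => x /=.
    by move=> h; split; [rewrite in_itv /=|move=> i; rewrite !mxE].
  rewrite in_itv /= => -[h0 h] i; case: (unliftP ord0 i) => [j|] ->//.
  by have := h j; rewrite !mxE.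
have mbox : measurable [set y : 'rV[R]_n | forall i, t a ord0 i <= y ord0 i <= t b ord0 i].
  rewrite (_ : mkset _ = \big[setI/setT]_(i < n)
      ((fun y : 'rV[R]_n => y ord0 i : R) @^-1` `[t a ord0 i, t b ord0 i]%classic)).
    apply: bigsetI_measurable => i _.
    by rewrite -[X in measurable X]setTI; exact: measurable_coord_rV.
  rewrite -bigcap_seq; apply/seteqP; split => [y /= h i _ /=|y /= h i].
    by rewrite in_itv /=; exact: h.
  by have := h i (mem_index_enum _); rewrite /= in_itv.
apply: (etrans (cons_measure_setX _ _ mbox)) => //.
rewrite [X in (_ * X)%E]ih; last by move=> i; rewrite !mxE.
rewrite lebesgue_measure_itv /= lte_fin big_ord_recl EFinM.
under eq_bigr do rewrite !mxE.
case: ltP => // ba; have -> : b ord0 ord0 = a ord0 ord0.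
  by apply/eqP; rewrite eq_le ba ab.
by rewrite subrr.
Qed.

Local Open Scope complex_scope.

Local Notation normc := ComplexField.Normc.normc.

Section complex_integration.
Context {R : realType} {dT : measure_display} {T : measurableType dT}.
Implicit Types (f : T -> R[i]) (nu : {charge set T -> \bar R}).

Definition cmeasurable_fun f :=
  measurable_fun setT (fun t => complex.Re (f t)) /\
  measurable_fun setT (fun t => complex.Im (f t)).

Definition cintegral (mu : {measure set T -> \bar R}) f : R[i] :=
  (\int[mu]_t complex.Re (f t)) +i* (\int[mu]_t complex.Im (f t)).

Definition hahn_pos_set nu := projT1 (cid (Hahn_decomposition nu)).
Definition hahn_neg_set nu :=
  projT1 (cid (projT2 (cid (Hahn_decomposition nu)))).
Definition hahn_setsP nu :
    hahn_decomposition nu (hahn_pos_set nu) (hahn_neg_set nu) :=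
  projT2 (cid (projT2 (cid (Hahn_decomposition nu)))).

Definition charge_integral nu (g : T -> R) : R :=
  (\int[jordan_pos (hahn_setsP nu)]_t g t) -
  (\int[jordan_neg (hahn_setsP nu)]_t g t).

(* A complex measure is given by its real and imaginary parts, which are
   finite signed measures. *)
Definition complex_measure : Type :=
  ({charge set T -> \bar R} * {charge set T -> \bar R})%type.

Definition complex_measure_integral (nu : complex_measure) f : R[i] :=
  (charge_integral nu.1 (fun t => complex.Re (f t)) -
   charge_integral nu.2 (fun t => complex.Im (f t))) +i*
  (charge_integral nu.1 (fun t => complex.Im (f t)) +
   charge_integral nu.2 (fun t => complex.Re (f t))).

End complex_integration.
Arguments complex_measure R {dT} T.

Section random_variables.
Context {R : realType} {dO : measure_display} {Omega : measurableType dO}.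
Variable P : probability Omega R.
Implicit Types X : Omega -> R[i].

Definition square_integrable X :=
  cmeasurable_fun X /\ (\int[P]_w (normc (X w) ^+ 2)%:E < +oo)%E.

Definition cexpectation X : R[i] := cintegral P X.

Definition cvariance X : \bar R :=
  (\int[P]_w (normc (X w - cexpectation X) ^+ 2)%:E)%E.

Definition cvg_L2 (X : nat -> Omega -> R[i]) (Y : Omega -> R[i]) :=
  (fun n => \int[P]_w (normc (X n w - Y w) ^+ 2)%:E)%E @ \oo --> 0%E.

End random_variables.

Section euclidean.
Context {R : realType} {d : nat}.
Implicit Types (u x : 'rV[R]_d) (f : 'rV[R]_d -> R[i]) (B : set 'rV[R]_d).

Definition dotr u x : R := \sum_i u ord0 i * x ord0 i.

Definition enorm u : R := Num.sqrt (dotr u u).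

Definition translate x f : 'rV[R]_d -> R[i] := fun y => f (y - x).

Definition fourier f u : R[i] :=
  cintegral (lebesgue_rV R d)
    (fun x => (cos (dotr u x) -i* sin (dotr u x)) * f x).

(* The class of bounded measurable functions with bounded support that
   vanish outside B. *)
Record Cbc B f : Prop := {
  Cbc_measurable : cmeasurable_fun f ;
  Cbc_bounded : exists k : R, forall x, normc (f x) <= k ;
  Cbc_bounded_support : bounded_set [set x | f x != 0] ;
  Cbc_support : [set x | f x != 0] `<=` B }.

Record closed_strictly_convex_cone B : Prop := {
  cone_closed : closed B ;
  cone_convex : convex_set (B : set (convex_lmodType 'rV[R]_d)) ;
  cone_scale : forall (t : R) x, 0 <= t -> B x -> B (t *: x) ;
  cone_strict : forall x, x != 0 -> ~ (B x /\ B (- x)) }.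

End euclidean.

Section random_measures.
Context {R : realType} {d : nat} {dO : measure_display}.
Context {Omega : measurableType dO} (P : probability Omega R).
(* Only the values of M on Cbc setT are relevant. *)
Variable M : ('rV[R]_d -> R[i]) -> Omega -> R[i].

(* In [wsrm_measure], M f is a random variable, hence only determined up to a
   null set depending on f; since f vanishes outside K, only the restriction
   of [mu w] to K matters.
   [wsrm_mean] is part of the usual meaning of weak stationarity; without it a
   deterministic M f = \int f dm, m a nonzero finite measure carried by B, has
   zero variance, hence zero spectral measure, but is not rigid on B. *)
Record weakly_stationary_random_measure : Prop := {
  wsrm_L2 : forall f, Cbc setT f -> square_integrable P (M f) ;
  wsrm_measure : forall K : set 'rV[R]_d, compact K ->
    exists mu : Omega -> complex_measure R 'rV[R]_d,
      forall f, Cbc K f ->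
        {ae P, forall w, M f w = complex_measure_integral (mu w) f} ;
  wsrm_variance : forall x f, Cbc setT f ->
    cvariance P (M (translate x f)) = cvariance P (M f) ;
  wsrm_mean : forall x f, Cbc setT f ->
    cexpectation P (M (translate x f)) = cexpectation P (M f) }.

Record spectral_measure (S : {measure set 'rV[R]_d -> \bar R}) : Prop := {
  spectral_symmetric : forall A : set 'rV[R]_d, measurable A -> S (-%R @^-1` A) = S A ;
  spectral_variance : forall f, Cbc setT f ->
    cvariance P (M f) =
    (((2 * pi) ^- d)%:E * \int[S]_u (normc (fourier f u) ^+ 2)%:E)%E ;
  spectral_growth : (\int[S]_u ((1 + enorm u) ^- d.+1)%:E < +oo)%E }.

Definition stealthy := exists S : {measure set 'rV[R]_d -> \bar R},
  spectral_measure S /\ exists O, [/\ open O, O !=set0 & S O = 0%E].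

Definition linearly_maximally_rigid (B : set 'rV[R]_d) :=
  forall f, Cbc B f ->
  exists h : nat -> 'rV[R]_d -> R[i],
    (forall n, Cbc (~` B) (h n)) /\ cvg_L2 P (fun n => M (h n)) (M f).

End random_measures.

(* Main.v *)
(** Write [S] for the spectral measure and fix [f] supported in the cone [B].
Replacing [f] by a finite combination [h = sum_j c_j f(. - x_j)] of its translates
multiplies its Fourier transform by [p(u) = sum_j c_j exp(-i u.x_j)], so
[E|M(h) - M(f)|^2] is the squared norm of [1 - p] in [L^2] of the finite measure
[(2 pi)^-d |fhat|^2 S + |E M(f)|^2 delta_0], which is null on [O \ {0}] for any
spectral gap [O]. As [B] lies in a simplicial cone [{x | a_i.x >= 0}], with
[a_i] a basis, it suffices to approximate [1] off a box [{u | |b_i.(u-u0)| <= e}]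
contained in [O \ {0}], where [b_i] is the dual basis, by characters whose frequency
satisfies [a_i.x <= -r] for some [i].

In one variable [v], the functions [exp(irv) (1 + irv/n)^-n] tend boundedly to
[1], and off the gap [|v| < e] the rational factor is uniformly close to a
function with poles in the lower half-plane only (Runge: the pole is pushed
through the gap), hence to a combination of characters [exp(ivt)] with [t >= 0].
This gives [p] with frequencies beyond [r] and [k] vanishing off the gap with
[k + p] close to [1]. Finally [prod_i (k_i + p_i)] is close to [1], [prod_i k_i]
vanishes off the box, and each term of their difference contains some [p_i]. *)

Require Import Defs.
From mathcomp Require Import all_boot all_order all_algebra.
From mathcomp Require Import finmap ring lra.
From mathcomp Require Import complex.
From mathcomp Require Import all_classical all_reals all_analysis measurable_realfun.

Set Implicit Arguments.
Unset Strict Implicit.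
Unset Printing Implicit Defensive.
Import Order.TTheory GRing.Theory Num.Theory.
Import numFieldNormedType.Exports.

Local Open Scope classical_set_scope.
Local Open Scope ring_scope.
Local Open Scope complex_scope.

Import ComplexField.Normc.

(** * Complex numbers and sequences *)

Section complex_numbers.
Context {R : realType}.
Implicit Types (z w : R[i]) (t : R).

Lemma normc_ge0 z : 0 <= normc z.
Proof. by case: z => a b; exact: sqrtr_ge0. Qed.

Lemma normc_real (a : R) : normc (a%:C) = `|a|.
Proof. by rewrite /= expr0n addr0 sqrtr_sqr. Qed.

Lemma sqr_normcE z : normc z ^+ 2 = complex.Re z ^+ 2 + complex.Im z ^+ 2.
Proof. by case: z => a b /=; rewrite sqr_sqrtr// addr_ge0// sqr_ge0. Qed.

Lemma normcB_sym z w : normc (z - w) = normc (w - z).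
Proof. by rewrite -normcN opprB. Qed.

Lemma normcX z n : normc (z ^+ n) = normc z ^+ n.
Proof.
elim: n => [|n ih]; first by rewrite !expr0 normc1.
by rewrite !exprS normcM ih.
Qed.

Lemma normr_Re_le z : `|complex.Re z| <= normc z.
Proof.
case: z => a b /=; rewrite -sqrtr_sqr ler_wsqrtr// lerDl; exact: sqr_ge0.
Qed.

Lemma normr_Im_le z : `|complex.Im z| <= normc z.
Proof.
case: z => a b /=; rewrite -sqrtr_sqr ler_wsqrtr// lerDr; exact: sqr_ge0.
Qed.

Lemma normc_le_ReIm z : normc z <= `|complex.Re z| + `|complex.Im z|.
Proof.
rewrite -(@ler_pXn2r _ 2%N)// ?nnegrE ?addr_ge0 ?normc_ge0//.
rewrite sqr_normcE sqrrD !real_normK ?num_real//.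
by rewrite addrAC lerDl mulrn_wge0// mulr_ge0.
Qed.

Lemma sqr_normcD_le z w : normc (z + w) ^+ 2 <= 2 * normc z ^+ 2 + 2 * normc w ^+ 2.
Proof.
apply: (@le_trans _ _ ((normc z + normc w) ^+ 2)).
  by rewrite ler_pXn2r ?nnegrE ?addr_ge0 ?normc_ge0// le_normcD.
rewrite -subr_ge0 (_ : _ - _ = (normc z - normc w) ^+ 2) ?sqr_ge0//; ring.
Qed.

(** Telescoping: the factors are exchanged one at a time, each at a cost of at most [|z - w|]
    because the others stay in the closed unit disc. *)
Lemma normc_subXX_le z w n : normc z <= 1 -> normc w <= 1 ->
  normc (z ^+ n - w ^+ n) <= n%:R * normc (z - w).
Proof.
move=> z1 w1; elim: n => [|n ih].
  by rewrite !expr0 subrr normc0 mul0r.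
have -> : z ^+ n.+1 - w ^+ n.+1 = z * (z ^+ n - w ^+ n) + (z - w) * w ^+ n.
  by rewrite !exprS; ring.
apply: (le_trans (le_normcD _ _)).
rewrite !normcM -natr1 mulrDl mul1r lerD//.
  by apply: le_trans ih; rewrite ler_piMl// normc_ge0.
by rewrite normcX ler_piMr ?normc_ge0// exprn_ile1// normc_ge0.
Qed.

Definition expi t : R[i] := cos t +i* sin t.

Lemma expi0 : expi 0 = 1.
Proof. by rewrite /expi cos0 sin0. Qed.

Lemma expiD t s : expi (t + s) = expi t * expi s.
Proof.
by rewrite /expi cosD sinD; apply/eqP; rewrite eq_complex /= eqxx addrC eqxx.
Qed.

Lemma normc_expi t : normc (expi t) = 1.
Proof. by rewrite /= cos2Dsin2 sqrtr1. Qed.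

Lemma expiMn t n : expi (t *+ n) = expi t ^+ n.
Proof.
elim: n => [|n ih]; first by rewrite mulr0n expi0 expr0.
by rewrite mulrS expiD ih exprS.
Qed.

End complex_numbers.

(** * Convergence of complex sequences and the second-order exponential remainder *)

Section complex_sequences.
Context {R : realType}.
Implicit Types (z w : nat -> R[i]) (k l : R[i]).

(** Stated through the modulus, so that real squeeze arguments apply directly. *)
Definition ccvg z l := (fun n => normc (z n - l)) @ \oo --> (0 : R).

Lemma ccvg_le (e : nat -> R) z l : (\forall n \near \oo, normc (z n - l) <= e n) ->
  e @ \oo --> (0 : R) -> ccvg z l.
Proof.
move=> ze e0; apply: (@squeeze_cvgr _ _ _ _ (fun=> 0) e) => //; last exact: cvg_cst.
by near=> n; rewrite normc_ge0 /=; near: n.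
Unshelve. all: by end_near. Qed.

Lemma ccvg_cst l : ccvg (fun=> l) l.
Proof.
apply: (@ccvg_le (fun=> 0)); last exact: cvg_cst.
by near=> n; rewrite subrr normc0.
Unshelve. all: by end_near. Qed.

Lemma ccvgD z w k l : ccvg z k -> ccvg w l -> ccvg (fun n => z n + w n) (k + l).
Proof.
move=> zk wl; apply: (@ccvg_le (fun n => normc (z n - k) + normc (w n - l))).
  by near=> n; rewrite opprD addrACA le_normcD.
by rewrite -(addr0 0); apply: cvgD.
Unshelve. all: by end_near. Qed.

Lemma ccvgM z w k l : ccvg z k -> ccvg w l -> ccvg (fun n => z n * w n) (k * l).
Proof.
move=> zk wl; apply: (@ccvg_le (fun n => normc (z n - k) * normc (w n - l) +
    normc (z n - k) * normc l + normc k * normc (w n - l))).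
  near=> n; rewrite (_ : _ - _ = (z n - k) * (w n - l) + (z n - k) * l + k * (w n - l)).
    rewrite -!normcM; apply: (le_trans (le_normcD _ _)).
    by rewrite lerD2r le_normcD.
  by ring.
rewrite (_ : 0 = 0 * 0 + 0 * normc l + normc k * 0); last by ring.
by apply: cvgD; [apply: cvgD; apply: cvgM => //; exact: cvg_cst|apply: cvgMr].
Unshelve. all: by end_near. Qed.

Lemma ccvgZ c w l : ccvg w l -> ccvg (fun n => c * w n) (c * l).
Proof. by move=> wl; apply: ccvgM => //; exact: ccvg_cst. Qed.

Lemma ccvg_prod (I : Type) (s : seq I) (z : I -> nat -> R[i]) (l : I -> R[i]) :
  (forall i, ccvg (z i) (l i)) ->
  ccvg (fun n => \prod_(i <- s) z i n) (\prod_(i <- s) l i).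
Proof.
move=> zl; elim: s => [|i s ih].
  rewrite big_nil; under eq_fun do rewrite big_nil; exact: ccvg_cst.
by rewrite big_cons; under eq_fun do rewrite big_cons; exact: ccvgM.
Qed.

(** Eventually [|z_n| >= |l|/2], which bounds the error [|l - z_n| / (|z_n| |l|)] by
    [2 |z_n - l| / |l|^2]. *)
Lemma ccvgV z l : l != 0 -> ccvg z l -> ccvg (fun n => (z n)^-1) l^-1.
Proof.
move=> l0 zl; have nl0 : 0 < normc l.
  by rewrite lt_neqAle normc_ge0 andbT eq_sym; apply: contra l0 => /eqP/eq0_normc ->.
have hz : \forall n \near \oo, normc l / 2 <= normc (z n).
  have /cvgrPdist_le/(_ (normc l / 2)) := zl; rewrite divr_gt0// => /(_ isT) h.
  near=> n; have : `|0 - normc (z n - l)| <= normc l / 2 by near: n.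
  rewrite sub0r normrN ger0_norm ?normc_ge0// normcB_sym => zn.
  have := le_normcD (l - z n) (z n); rewrite subrK; lra.
apply: (@ccvg_le (fun n => 2 / normc l ^+ 2 * normc (z n - l))).
  near=> n.
  have zn : normc l / 2 <= normc (z n) by near: n.
  have zn0 : 0 < normc (z n) by apply: lt_le_trans zn; rewrite divr_gt0.
  have z0 : z n != 0 by apply: contraTneq zn0 => ->; rewrite normc0 ltxx.
  rewrite (_ : _ - _ = (l - z n) / (z n * l)); last by field; rewrite l0 z0.
  rewrite normcM normcV normcM normcB_sym mulrC ler_wpM2r ?normc_ge0//.
  rewrite -div1r ler_pdivrMr ?mulr_gt0// mulrAC ler_pdivlMr ?exprn_gt0//.
  rewrite mul1r expr2 mulrA ler_wpM2r ?normc_ge0//; lra.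
rewrite -(mulr0 (2 / normc l ^+ 2)); exact: cvgMr.
Unshelve. all: by end_near. Qed.

Lemma ccvg_real0 (e : nat -> R) : e @ \oo --> (0 : R) -> ccvg (fun n => (e n)%:C) 0.
Proof.
move=> e0; apply: (@ccvg_le (fun n => `|e n|)).
  by near=> n; rewrite subr0 normc_real.
by rewrite -(@normr0 _ R); apply: cvg_norm.
Unshelve. all: by end_near. Qed.

Lemma derivative_bound (f df : R -> R) (K x : R) :
  (forall y : R, is_derive y 1 f (df y)) -> (forall y, `|y| <= `|x| -> `|df y| <= K) ->
  `|f x - f 0| <= K * `|x|.
Proof.
move=> fdf dfK.
have cf : continuous f.
  by move=> y; apply: differentiable_continuous; apply/derivable1_diffP; have [] := fdf y.
have cfw (A : set R) : {within A, continuous f} by exact: continuous_subspaceT.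
have [x0|/ltW x0] := leP 0 x.
  have [c] := MVT_segment x0 (fun y _ => fdf y) (cfw _).
  rewrite in_itv /= => /andP[c0 cx] ->.
  by rewrite subr0 normrM ler_wpM2r// dfK// !ger0_norm.
have [c] := MVT_segment x0 (fun y _ => fdf y) (cfw _).
rewrite in_itv /= => /andP[c0 cx]; rewrite distrC => ->.
by rewrite sub0r normrM normrN ler_wpM2r// dfK// !ler0_norm// lerN2.
Qed.

(** The two parts of the remainder, [cos x - 1] and [sin x - x], have derivatives bounded by [|x|]
    on [[-|x|, |x|]], so each is at most [x^2]. *)
Lemma normc_expi_sub (x : R) : normc (expi x - (1 +i* x)) <= 2 * x ^+ 2.
Proof.
have sin_le y : `|sin y : R| <= `|y|.
  rewrite -[X in `|X|]subr0 -sin0 -[leRHS]mul1r.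
  apply: (derivative_bound (df := cos)) => t _.
  by rewrite ler_norml cos_geN1 cos_le1.
have cos_le y : `|cos y - 1 : R| <= `|y|.
  rewrite -cos0 -[leRHS]mul1r.
  apply: (@derivative_bound cos (fun t => - sin t) 1) => t _.
  by rewrite normrN ler_norml sin_geN1 sin_le1.
apply: (le_trans (normc_le_ReIm _)) => /=.
rewrite -real_normK ?num_real// mulr_natl mulr2n expr2 lerD//.
  rewrite -cos0; apply: (@derivative_bound cos (fun t => - sin t)) => y yx.
  by rewrite normrN (le_trans (sin_le y)).
have := @derivative_bound (fun y => sin y - y) (fun y => cos y - 1) `|x| x.
rewrite sin0 subrr subr0; apply => y yx; last exact: le_trans (cos_le y) _.
Qed.

End complex_sequences.

(** * Bounded limits of trigonometric polynomials *)

Section bounded_closure.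
Context {R : realType} {d : nat}.
Implicit Types (u x y : 'rV[R]_d) (X Y Z : set 'rV[R]_d) (w p : 'rV[R]_d -> R[i]).

Lemma dotrDl u v x : dotr (u + v) x = dotr u x + dotr v x.
Proof. by rewrite /dotr -big_split; apply: eq_bigr => i _; rewrite mxE mulrDl. Qed.

Lemma dotrZl (t : R) u x : dotr (t *: u) x = t * dotr u x.
Proof. by rewrite /dotr mulr_sumr; apply: eq_bigr => i _; rewrite mxE mulrA. Qed.

Lemma dotrC u x : dotr u x = dotr x u.
Proof. by apply: eq_bigr => i _; rewrite mulrC. Qed.

Lemma dotrDr u x y : dotr u (x + y) = dotr u x + dotr u y.
Proof. by rewrite dotrC dotrDl !(dotrC u). Qed.

Lemma dotrZr (t : R) u x : dotr u (t *: x) = t * dotr u x.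
Proof. by rewrite dotrC dotrZl (dotrC u). Qed.

Lemma dotr0l x : dotr 0 x = 0.
Proof. by rewrite -(scale0r (0 : 'rV[R]_d)) dotrZl mul0r. Qed.

Lemma dotrNr u x : dotr u (- x) = - dotr u x.
Proof. by rewrite -scaleN1r dotrZr mulN1r. Qed.

Lemma dotrNl u x : dotr (- u) x = - dotr u x.
Proof. by rewrite -scaleN1r dotrZl mulN1r. Qed.

(** The sign matches [fourier]: translating a function by [x] multiplies its Fourier transform by
    [character x]. *)
Definition character x u : R[i] := expi (- dotr u x).

Lemma characterD x y u : character (x + y) u = character x u * character y u.
Proof. by rewrite /character dotrDr opprD expiD. Qed.

Inductive trig X : ('rV[R]_d -> R[i]) -> Prop :=
| trig0 : trig X (fun=> 0)
| trig_add c x p : X x -> trig X p -> trig X (fun u => c * character x u + p u).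

(* Measure-free stand-in for the closure of [trig X] in [L^2]: by dominated
   convergence it is contained in that closure for every finite measure. *)
Inductive bclosure X : ('rV[R]_d -> R[i]) -> Prop :=
| bclosure0 : bclosure X (fun=> 0)
| bclosure_char x : X x -> bclosure X (character x)
| bclosure_lin c w1 w2 : bclosure X w1 -> bclosure X w2 ->
    bclosure X (fun u => c * w1 u + w2 u)
| bclosure_lim (w_ : nat -> 'rV[R]_d -> R[i]) w (C : R) :
    (forall n, bclosure X (w_ n)) -> (forall n u, normc (w_ n u) <= C) ->
    (forall u, ccvg (w_ ^~ u) (w u)) -> bclosure X w.

Lemma bclosure_eq X w w' : bclosure X w -> w =1 w' -> bclosure X w'.
Proof. by move=> Xw /funext <-. Qed.

Lemma bclosureZ X c w : bclosure X w -> bclosure X (fun u => c * w u).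
Proof.
move=> Xw; apply: bclosure_eq (bclosure_lin c Xw (bclosure0 X)) _ => u.
by rewrite addr0.
Qed.

Lemma bclosureD X w1 w2 : bclosure X w1 -> bclosure X w2 ->
  bclosure X (fun u => w1 u + w2 u).
Proof.
move=> X1 X2; apply: bclosure_eq (bclosure_lin 1 X1 X2) _ => u.
by rewrite mul1r.
Qed.

Lemma bclosureB X w1 w2 : bclosure X w1 -> bclosure X w2 ->
  bclosure X (fun u => w1 u - w2 u).
Proof.
move=> X1 X2; apply: bclosure_eq (bclosure_lin (-1) X2 X1) _ => u.
by rewrite mulN1r addrC.
Qed.

Lemma bclosure1 X : X 0 -> bclosure X (fun=> 1).
Proof.
move=> X0; apply: bclosure_eq (bclosure_char X0) _ => u.
by rewrite /character dotrC dotr0l oppr0 expi0.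
Qed.

Lemma bclosure_cst X c : X 0 -> bclosure X (fun=> c).
Proof.
move=> X0; apply: bclosure_eq (bclosureZ c (bclosure1 X0)) _ => u.
by rewrite mulr1.
Qed.

Lemma bclosure_sub X Y w : X `<=` Y -> bclosure X w -> bclosure Y w.
Proof.
move=> XY; elim=> [|x /XY/bclosure_char//|c w1 w2 _ h1 _ h2|w_ w' C _ h wC wl].
- exact: bclosure0.
- exact: bclosure_lin.
- exact: bclosure_lim wC wl.
Qed.

(** Boundedness survives limits because [bclosure_lim] carries a uniform bound; products of limits
    rely on it. *)
Lemma bclosure_bounded X w : bclosure X w -> exists C, forall u, normc (w u) <= C.
Proof.
elim=> [|x _|c w1 w2 _ [C1 h1] _ [C2 h2]|w_ w' C _ _ wC wl].
- by exists 0 => u; rewrite normc0.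
- by exists 1 => u; rewrite normc_expi.
- exists (normc c * C1 + C2) => u; apply: (le_trans (le_normcD _ _)).
  by rewrite lerD// normcM ler_wpM2l// normc_ge0.
- exists C => u; apply/ler_addgt0Pl => e e0.
  have /cvgrPdist_le/(_ _ e0)[n _ /(_ n (leqnn n))] := wl u.
  rewrite sub0r normrN ger0_norm ?normc_ge0// normcB_sym => h.
  have := le_normcD (w' u - w_ n u) (w_ n u); rewrite subrK => /le_trans; apply.
  by rewrite lerD.
Qed.

(** Induction on [w1]; only when [w1] is a character is an induction on [w2] required. In both limit
    cases the fixed factor is bounded, so the products stay uniformly bounded. *)
Lemma bclosureM X Y Z w1 w2 : (forall x y, X x -> Y y -> Z (x + y)) ->
  bclosure X w1 -> bclosure Y w2 -> bclosure Z (fun u => w1 u * w2 u).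
Proof.
move=> XYZ + Y2; have [C2 w2C] := bclosure_bounded Y2.
have C2_ge0 : 0 <= C2 by exact: le_trans (normc_ge0 _) (w2C 0).
elim=> [|x Xx|c w w' _ h _ h'|w_ w C _ h wC wl].
- by apply: bclosure_eq (bclosure0 Z) _ => u; rewrite mul0r.
- elim: Y2 {w2C} => [|y Yy|c w w' _ h _ h'|w_ w C _ h wC wl].
  + by apply: bclosure_eq (bclosure0 Z) _ => u; rewrite mulr0.
  + by apply: bclosure_eq (bclosure_char (XYZ _ _ Xx Yy)) _ => u; rewrite characterD.
  + by apply: bclosure_eq (bclosure_lin c h h') _ => u; ring.
  + apply: (bclosure_lim (C := C) h) => [n u|u].
      by rewrite normcM normc_expi mul1r.
    exact: ccvgZ.
- by apply: bclosure_eq (bclosure_lin c h h') _ => u; ring.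
- apply: (bclosure_lim (C := C * C2) h) => [n u|u].
    by rewrite normcM ler_pM ?normc_ge0.
  by apply: ccvgM => //; exact: ccvg_cst.
Qed.

Lemma bclosureX X w n : X 0 -> (forall x y, X x -> X y -> X (x + y)) ->
  bclosure X w -> bclosure X (fun u => w u ^+ n).
Proof.
move=> X0 XD Xw; elim: n => [|n ih]; first exact: bclosure1.
by under eq_fun do rewrite exprS; apply: bclosureM Xw ih.
Qed.

End bounded_closure.

(** * Resolvents with poles in the lower half-plane *)

Section resolvents.
Context {R : realType} {d : nat}.
Implicit Types (u b x : 'rV[R]_d) (X : set 'rV[R]_d) (w : 'rV[R]_d -> R[i]).

Lemma expi_quotient_cvg (h : nat -> R) (x : R) : (forall n, 0 < h n) ->
  h @ \oo --> (0 : R) ->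
  ccvg (fun n => (expi (h n * x) - 1) / (h n)%:C) (0 +i* x).
Proof.
move=> h_gt0 h0; apply: (@ccvg_le _ (fun n => 2 * x ^+ 2 * h n)).
  near=> n.
  have hn0 : (h n)%:C != 0 :> R[i] by rewrite eq_complex /= negb_and (gt_eqF (h_gt0 n)).
  rewrite (_ : _ - _ = (expi (h n * x) - (1 +i* (h n * x))) / (h n)%:C).
    rewrite normcM normcV normc_real gtr0_norm// ler_pdivrMr//.
    by rewrite (le_trans (normc_expi_sub _))// exprMn; nra.
  apply: (mulIf hn0); rewrite mulfVK// mulrBl mulfVK//.
  apply/eqP; rewrite eq_complex /=; apply/andP; split; apply/eqP; ring.
by rewrite -(mulr0 (2 * x ^+ 2)); exact: cvgMr.
Unshelve. all: by end_near. Qed.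

(** The partial sums of the geometric series in [w] are bounded by [(1 - q)^-1] and converge
    pointwise. *)
Lemma bclosure_neumann X w (q : R) : X 0 -> (forall x y, X x -> X y -> X (x + y)) ->
  bclosure X w -> q < 1 -> (forall u, normc (w u) <= q) ->
  bclosure X (fun u => (1 - w u)^-1).
Proof.
move=> X0 XD Xw q1 wq.
have q0 : 0 <= q := le_trans (normc_ge0 _) (wq 0).
have w1 u : 1 - w u != 0.
  apply: contraTneq (wq u) => /eqP; rewrite subr_eq0 => /eqP <-.
  by rewrite normc1 -ltNge.
have geom u n : \sum_(i < n) w u ^+ i = (1 - w u ^+ n) / (1 - w u).
  by apply: (mulIf (w1 u)); rewrite mulfVK// -[RHS]opprB subrX1; ring.
apply: (bclosure_lim (w_ := fun n u => \sum_(i < n) w u ^+ i) (C := (1 - q)^-1)).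
- elim=> [|n ih].
    by apply: bclosure_eq (bclosure0 X) _ => u; rewrite big_ord0.
  apply: bclosure_eq (bclosureD ih (bclosureX n X0 XD Xw)) _ => u.
  by rewrite big_ord_recr.
- move=> n u; apply: (@le_trans _ _ (\sum_(i < n) q ^+ i)).
    elim: n => [|n ih]; first by rewrite !big_ord0 normc0.
    rewrite !big_ord_recr /= (le_trans (le_normcD _ _))// lerD//.
    by rewrite normcX lerXn2r ?nnegrE ?normc_ge0.
  rewrite -[leRHS]mul1r ler_pdivlMr ?subr_gt0//.
  rewrite (_ : _ * _ = 1 - q ^+ n) ?gerBl ?exprn_ge0//.
  rewrite -[RHS]opprB subrX1; ring.
- move=> u; rewrite -[(1 - w u)^-1]mul1r; under eq_fun do rewrite geom.
  apply: ccvgM; last exact: ccvg_cst.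
  apply: (@ccvg_le _ (geometric 1 q)).
    near=> n; rewrite addrAC subrr sub0r normcN normcX /= mul1r.
    by rewrite lerXn2r ?nnegrE ?normc_ge0.
  by apply: cvg_geometric; rewrite ger0_norm.
Unshelve. all: by end_near. Qed.

Definition line b (A : set R) : set 'rV[R]_d := (fun t => t *: b) @` A.

Lemma line0 b A : A 0 -> line b A 0.
Proof. by exists 0 => //; rewrite scale0r. Qed.

Lemma lineD b (A A' A'' : set R) : (forall s t, A s -> A' t -> A'' (s + t)) ->
  forall x y, line b A x -> line b A' y -> line b A'' (x + y).
Proof. by move=> AD _ _ [s As <-] [t At <-]; exists (s + t); [exact: AD|rewrite scalerDl]. Qed.

Variables (b u0 : 'rV[R]_d).
Let v u := dotr b (u - u0).

(** Characters carry a minus sign, hence [- s]; the base point [u0] only contributes a constant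
    factor of modulus one. *)
Lemma bclosure_expi (s : R) A : A (- s) -> bclosure (line b A) (fun u => expi (s * v u)).
Proof.
move=> As; have sb : line b A (- s *: b) by exists (- s).
apply: bclosure_eq (bclosureZ (expi (- (s * dotr b u0))) (bclosure_char sb)) _ => u.
rewrite /character -expiD; congr expi.
by rewrite /v dotrDr dotrNr dotrZr (dotrC u); ring.
Qed.

(** Discrete form of the Laplace formula [1/(z - iv) = int_0^oo exp(-zt) exp(ivt) dt]: the geometric
    series of ratio [q exp(ihv)], times the step [h], with [q = 1/(1 + hz)] in place of
    [exp(-hz)]. *)
Lemma bclosure_resolvent_gt0 (z : R) : 0 < z ->
  bclosure (line b [set t | t <= 0]) (fun u => (z -i* v u)^-1).
Proof.
move=> z0; set X := line b _.
have X0 : X 0 by apply: line0 => /=.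
have XD x y : X x -> X y -> X (x + y).
  by apply: lineD => s t /= s0 t0; rewrite -(addr0 0) lerD.
pose h n : R := harmonic n.
have h0 n : 0 < h n by exact: harmonic_gt0.
pose q n := (1 + h n * z)^-1.
have q0 n : 0 < q n by rewrite invr_gt0 addr_gt0// mulr_gt0.
have q1 n : q n < 1 by rewrite invf_lt1 ?addr_gt0// ?mulr_gt0// ltrDl mulr_gt0.
have qe n u : normc ((q n)%:C * expi (h n * v u)) <= q n.
  by rewrite normcM normc_expi mulr1 normc_real gtr0_norm.
apply: (bclosure_lim
  (w_ := fun n u => (h n)%:C * (1 - (q n)%:C * expi (h n * v u))^-1) (C := (1 + z) / z)).
- move=> n; apply: bclosureZ.
  apply: (bclosure_neumann X0 XD _ (q1 n)) => //.
  by apply/bclosureZ/bclosure_expi => /=; rewrite oppr_le0 ltW.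
(* Since [1 - q = hzq], the modulus is at most [h / (1 - q) = (1 + hz) / z], and [h <= 1] gives the
   constant [(1 + z) / z]. *)
- move=> n u; rewrite normcM normcV normc_real gtr0_norm//.
  have : 1 - q n <= normc (1 - (q n)%:C * expi (h n * v u)).
    have := le_normcD (1 - (q n)%:C * expi (h n * v u)) ((q n)%:C * expi (h n * v u)).
    by rewrite subrK normc1; have := qe n u; lra.
  move=> hq; have q1' : 0 < 1 - q n by rewrite subr_gt0.
  rewrite ler_pdivrMr ?(lt_le_trans q1')//.
  apply: (@le_trans _ _ ((1 + z) / z * (1 - q n))); last first.
    by rewrite ler_wpM2l// divr_ge0 ?addr_ge0 ?ltW.
  have -> : 1 - q n = h n * z * q n.
    by rewrite /q; field; rewrite gt_eqF// addr_gt0// mulr_gt0.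
  rewrite (_ : _ * _ = h n * ((1 + z) * q n)); last by field; rewrite gt_eqF.
  rewrite ler_pMr// ler_pdivlMr ?addr_gt0 ?mulr_gt0// mul1r lerD2l ler_piMl ?(ltW z0)//.
  by rewrite /h /harmonic /= invf_le1 ?ler1n.
- move=> u.
  have zv : z -i* v u != 0 :> R[i] by rewrite eq_complex /= negb_and gt_eqF.
  have hC n : (h n)%:C != 0 :> R[i] by rewrite eq_complex /= negb_and (gt_eqF (h0 n)).
  have qC n : (q n)%:C = (1 + (h n)%:C * z%:C)^-1.
    by rewrite /q fmorphV rmorphD rmorphM.
  have qC0 n : 1 + (h n)%:C * z%:C != 0 :> R[i].
    by rewrite -rmorphM -(rmorphD _ 1) eq_complex /= negb_and gt_eqF// addr_gt0// mulr_gt0.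
  (* The inverses equal [(1 + hz)^-1 (z - (exp(ihv) - 1)/h)], so only the derivative of the
     exponential at 0 is involved. *)
  suff: ccvg (fun n => (1 + (h n)%:C * z%:C)^-1 * (z%:C - (expi (h n * v u) - 1) / (h n)%:C))
      (z -i* v u).
    move/(ccvgV zv); congr (ccvg _ _); apply/funext => n.
    rewrite qC -[LHS]mulr1 -[X in _ * X = _](divff (hC n)).
    rewrite mulrCA -invfM; congr (_ * _^-1).
    by field; rewrite hC qC0.
  rewrite (_ : z -i* v u = (1 + 0 * z%:C)^-1 * (z%:C + -1 * (0 +i* v u))); last first.
    by rewrite mul0r addr0 invr1 mul1r mulN1r; apply/eqP; rewrite eq_complex /= subr0 add0r !eqxx.
  apply: ccvgM.
    apply: ccvgV; first by rewrite mul0r addr0 oner_eq0.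
    apply: ccvgD; first exact: ccvg_cst.
    apply: ccvgM; last exact: ccvg_cst.
    by apply: ccvg_real0; exact: cvg_harmonic.
  under eq_fun do rewrite -[X in _ + X]mulN1r.
  apply: ccvgD; first exact: ccvg_cst.
  by apply: ccvgZ; apply: expi_quotient_cvg => //; exact: cvg_harmonic.
Qed.

End resolvents.

(** * Runge approximation through the spectral gap *)

(** Each [y^i] with [i < n] is at least [y^n], so [n y^n] is at most the partial geometric sum. *)
Lemma mulrn_expr_bounded (R : realType) (y : R) n : 0 <= y -> y < 1 ->
  n%:R * y ^+ n <= (1 - y)^-1.
Proof.
move=> y0 y1; rewrite -[leRHS]mul1r ler_pdivlMr ?subr_gt0//.
apply: (@le_trans _ _ ((\sum_(i < n) y ^+ i) * (1 - y))).
  rewrite ler_wpM2r ?subr_ge0 ?(ltW y1)// mulr_natl.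
  have -> : y ^+ n *+ n = \sum_(i < n) y ^+ n by rewrite sumr_const card_ord.
  rewrite ler_sum// => i _.
  by rewrite ler_wiXn2l ?(ltW y1)// ltnW.
rewrite (_ : _ * _ = 1 - y ^+ n) ?gerBl ?exprn_ge0//.
rewrite -[RHS]opprB subrX1; ring.
Qed.

(** With [y = sqrt x], [n x^n = (n y^n) y^n] is a bounded factor times a vanishing one. *)
Lemma cvg_mulrn_expr (R : realType) (x : R) : 0 <= x -> x < 1 ->
  (fun n => n%:R * x ^+ n) @ \oo --> (0 : R).
Proof.
move=> x0 x1; pose y := Num.sqrt x.
have y0 : 0 <= y by exact: sqrtr_ge0.
have y1 : y < 1 by rewrite -sqrtr1 ltr_sqrt.
apply: (@squeeze_cvgr _ _ _ _ (fun=> 0) (geometric (1 - y)^-1 y)).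
- near=> n; rewrite mulr_ge0 ?exprn_ge0//= -(sqr_sqrtr x0) -exprM mul2n -addnn.
  rewrite exprD mulrA ler_wpM2r ?exprn_ge0//; exact: mulrn_expr_bounded.
- exact: cvg_cst.
- by apply: cvg_geometric; rewrite ger0_norm.
Unshelve. all: by end_near. Qed.

(* The exponent [n * 2 ^ n] makes the limit at the threshold [s = 1/2] equal to 0. *)
Lemma cvg_threshold (R : realType) (s : R) : 0 <= s -> s <= 1 ->
  (fun n => (1 - s ^+ n) ^+ (n * 2 ^ n)) @ \oo --> (if s < 1 / 2 then 1 else 0 : R).
Proof.
move=> s0 s1.
have sn0 n : 0 <= 1 - s ^+ n by rewrite subr_ge0 exprn_ile1.
have sn1 n : 1 - s ^+ n <= 1 by rewrite gerBl exprn_ge0.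
have bern (y : R) N : 0 <= y -> 1 + N%:R * y <= (1 + y) ^+ N.
  move=> y0; elim: N => [|N ih]; first by rewrite mul0r addr0 expr0.
  rewrite exprS -natr1; apply: (@le_trans _ _ ((1 + y) * (1 + N%:R * y))).
    have : 0 <= N%:R * y * y by rewrite !mulr_ge0. nra.
  by rewrite ler_wpM2l// addr_ge0.
have bern1 (y : R) N : 0 <= y -> y <= 1 -> 1 - N%:R * y <= (1 - y) ^+ N.
  move=> y0 y1; elim: N => [|N ih]; first by rewrite mul0r subr0 expr0.
  rewrite exprS -natr1; apply: (@le_trans _ _ ((1 - y) * (1 - N%:R * y))).
    have : 0 <= N%:R * y * y by rewrite !mulr_ge0. nra.
  by rewrite ler_wpM2l// subr_ge0.
(* For [N = n 2^n], the quantity in Bernoulli's inequality is [N s^n = n (2s)^n], which tends to 0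
   when [s < 1/2] and is at least [n] otherwise. *)
have Ns n : (n * 2 ^ n)%:R * s ^+ n = n%:R * (2 * s) ^+ n.
  by rewrite natrM natrX exprMn mulrA.
case: ltP => s2.
  apply: (@squeeze_cvgr _ _ _ _ (fun n => 1 - n%:R * (2 * s) ^+ n) (fun=> 1)).
  - near=> n; rewrite -Ns bern1 ?exprn_ge0 ?exprn_ile1//=.
  - rewrite -[X in _ --> X]subr0; apply: cvgB; first exact: cvg_cst.
    by apply: cvg_mulrn_expr; lra.
  - exact: cvg_cst.
apply: (@squeeze_cvgr _ _ _ _ (fun=> 0) harmonic).
- near=> n; rewrite exprn_ge0//= /harmonic.
  rewrite -[leRHS]mul1r ler_pdivlMr// -natr1.
  (* Here [(1 - s^n)^N (1 + s^n)^N <= 1], while [(1 + s^n)^N >= 1 + N s^n >= n + 1]. *)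
  apply: (@le_trans _ _ ((1 - s ^+ n) ^+ (n * 2 ^ n) * (1 + s ^+ n) ^+ (n * 2 ^ n))).
    rewrite ler_wpM2l ?exprn_ge0//.
    apply: le_trans (bern _ _ _); last exact: exprn_ge0.
    by rewrite Ns addrC lerD2l ler_peMr// exprn_ege1//; lra.
  rewrite -exprMn exprn_ile1//.
    by rewrite mulr_ge0// addr_ge0// exprn_ge0.
  have : 0 <= s ^+ n by rewrite exprn_ge0. nra.
- exact: cvg_cst.
- exact: cvg_harmonic.
Unshelve. all: by end_near. Qed.

(** * Uniform approximation off a slab by one-sided frequencies *)

Section slab.
Context {R : realType} {d : nat}.
Variables (b u0 : 'rV[R]_d) (e : R).
Hypothesis e0 : 0 < e.
Implicit Types (u : 'rV[R]_d) (w p : 'rV[R]_d -> R[i]).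

Let v u := dotr b (u - u0).
Let X := line b [set t | t <= 0].

Let X0 : X 0. Proof. by apply: line0 => /=. Qed.

Let XD x y : X x -> X y -> X (x + y).
Proof. by apply: lineD => s t /= s0 t0; rewrite -(addr0 0) lerD. Qed.

(** Nothing is asked inside the slab [|v| < e]; this freedom is what lets a pole cross it. *)
Definition outer_approx w := forall eta : R, 0 < eta -> exists2 p, bclosure X p &
  forall u, e <= `|v u| -> normc (w u - p u) <= eta.

Lemma outer_approx_bclosure w : bclosure X w -> outer_approx w.
Proof. by move=> Xw eta /ltW; exists w => // u _; rewrite subrr normc0. Qed.

Lemma outer_approx_eq w w' : outer_approx w ->
  (forall u, e <= `|v u| -> w' u = w u) -> outer_approx w'.
Proof.
move=> aw ww' eta /aw[p Xp wp]; exists p => // u eu.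
by rewrite ww'// wp.
Qed.

Lemma outer_approx_lim w : (forall eta : R, 0 < eta -> exists2 w', outer_approx w' &
    forall u, e <= `|v u| -> normc (w u - w' u) <= eta) -> outer_approx w.
Proof.
move=> h eta eta0; have [w' /(_ (eta / 2)) + ww'] := h _ (divr_gt0 eta0 (ltr0Sn _ 1)).
rewrite divr_gt0// => /(_ isT)[p Xp w'p]; exists p => // u eu.
rewrite -(subrKA (w' u)) (le_trans (le_normcD _ _))// (splitr eta) lerD//; [exact: ww'|exact: w'p].
Qed.

Lemma outer_approx_bounded w : outer_approx w ->
  exists2 C : R, 0 < C & forall u, e <= `|v u| -> normc (w u) <= C.
Proof.
move=> /(_ 1 ltr01)[p /bclosure_bounded[C pC] wp].
have C0 : 0 <= C := le_trans (normc_ge0 _) (pC 0).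
exists (1 + C) => [|u eu]; first by rewrite ltr_wpDr.
by have := le_normcD (w u - p u) (p u); rewrite subrK => /le_trans; apply; rewrite lerD// wp.
Qed.

Lemma outer_approxD w1 w2 : outer_approx w1 -> outer_approx w2 ->
  outer_approx (fun u => w1 u + w2 u).
Proof.
move=> a1 a2 eta eta0; have eta20 : 0 < eta / 2 by rewrite divr_gt0.
have [p1 X1 h1] := a1 _ eta20; have [p2 X2 h2] := a2 _ eta20.
exists (fun u => p1 u + p2 u); first exact: bclosureD.
move=> u eu; rewrite opprD addrACA (le_trans (le_normcD _ _))// (splitr eta) lerD//.
  exact: h1.
exact: h2.
Qed.

Lemma outer_approxM w1 w2 : outer_approx w1 -> outer_approx w2 ->
  outer_approx (fun u => w1 u * w2 u).
Proof.
move=> a1 a2 eta eta0.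
(* The order matters: [p2] is chosen from a bound on [w1], and only then [p1] from a bound on
   [p2]. *)
have [C C0 w1C] := outer_approx_bounded a1.
have [p2 X2 h2] := a2 _ (divr_gt0 (divr_gt0 eta0 (ltr0Sn _ 1)) C0).
have [D0 p2D] := bclosure_bounded X2.
pose D := 1 + D0; have D_gt0 : 0 < D.
  by rewrite ltr_wpDr// (le_trans (normc_ge0 _) (p2D 0)).
have [p1 X1 h1] := a1 _ (divr_gt0 (divr_gt0 eta0 (ltr0Sn _ 1)) D_gt0).
exists (fun u => p1 u * p2 u); first exact: bclosureM XD X1 X2.
move=> u eu; rewrite (_ : _ - _ = w1 u * (w2 u - p2 u) + (w1 u - p1 u) * p2 u); last by ring.
rewrite (le_trans (le_normcD _ _))// (splitr eta) !normcM lerD//.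
  rewrite -[leRHS](divfK (lt0r_neq0 C0)) mulrC.
  by apply: ler_pM; rewrite ?normc_ge0 ?h2 ?w1C.
rewrite -[leRHS](divfK (lt0r_neq0 D_gt0)).
apply: ler_pM; rewrite ?normc_ge0 ?h1//.
by rewrite (le_trans (p2D u))// lerDr.
Qed.

Lemma outer_approx_cst c : outer_approx (fun=> c).
Proof. exact/outer_approx_bclosure/bclosure_cst. Qed.

Lemma outer_approxX w n : outer_approx w -> outer_approx (fun u => w u ^+ n).
Proof.
move=> aw; elim: n => [|n ih]; first exact: outer_approx_cst.
by under eq_fun do rewrite exprS; exact: outer_approxM.
Qed.

(** Off the slab the geometric series converges uniformly, with remainder [w^n / (1 - w)] at most
    [q^n / (1 - q)]. *)
Lemma outer_approx_neumann w q : outer_approx w -> 0 <= q -> q < 1 ->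
  (forall u, e <= `|v u| -> normc (w u) <= q) -> outer_approx (fun u => (1 - w u)^-1).
Proof.
move=> aw q0 q1 wq; apply: outer_approx_lim => eta eta0.
have : geometric (1 - q)^-1 q @ \oo --> (0 : R).
  by apply: cvg_geometric; rewrite ger0_norm.
move=> /cvgrPdist_le/(_ _ eta0)[n _ /(_ n (leqnn n))] /=.
rewrite sub0r normrN ger0_norm; last first.
  by rewrite mulr_ge0 ?exprn_ge0// invr_ge0 subr_ge0 ltW.
move=> qn; exists (fun u => \sum_(i < n) w u ^+ i).
  elim: n {qn} => [|n ih].
    by apply: outer_approx_eq (outer_approx_cst 0) _ => u _; rewrite big_ord0.
  apply: outer_approx_eq (outer_approxD ih (outer_approxX n aw)) _ => u _.
  by rewrite big_ord_recr.
move=> u eu; have w1 : 1 - q <= normc (1 - w u).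
  have := le_normcD (1 - w u) (w u); rewrite subrK normc1.
  have := wq _ eu; lra.
have w1' : 1 - w u != 0.
  by apply: contraTneq w1 => ->; rewrite normc0 subr_le0 -ltNge.
rewrite (_ : _ - _ = w u ^+ n / (1 - w u)).
  rewrite normcM normcV normcX (le_trans _ qn)// mulrC.
  rewrite ler_pM ?invr_ge0 ?normc_ge0 ?exprn_ge0 ?normc_ge0//.
    rewrite lef_pV2// posrE ?subr_gt0//; apply: lt_le_trans w1.
    by rewrite subr_gt0.
  by rewrite lerXn2r ?nnegrE ?normc_ge0// wq.
apply: (mulIf w1'); rewrite mulrBl mulfVK// mulVf//.
rewrite -[w u ^+ n](subrK 1) subrX1; ring.
Qed.

(* Moving the pole by [e / 2] at a time from the lower half-plane, through the
   slab [|v| < e], to any point of the imaginary axis. *)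
Lemma outer_approx_resolvent (z : R) : outer_approx (fun u => (z -i* v u)^-1).
Proof.
(* Induction on a number [k] of shifts by [e / 2] that brings the parameter [z] above 0. *)
suff : forall k (z : R), - (k%:R * (e / 2)) < z -> outer_approx (fun u => (z -i* v u)^-1).
  move=> /(_ (Num.truncn (`|z| / (e / 2))).+1); apply.
  rewrite ltrNl; apply: (@le_lt_trans _ _ `|z|); first by rewrite -normrN ler_norm.
  rewrite -ltr_pdivrMr ?divr_gt0//; exact: Num.Theory.truncnS_gt.
elim=> [|k ih] {}z.
  by rewrite mul0r oppr0 => z0; exact/outer_approx_bclosure/bclosure_resolvent_gt0.
rewrite -natr1 mulrDl mul1r opprD ltrBlDr => /ih.
(* With [q = (e/2)/(y - iv)], the resolvent at [z] is the one at [y] divided by [1 - q]. Off the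
   slab [|y - iv| >= |v| >= e], so [|q| <= 1/2] and the geometric series applies. *)
set y := z + e / 2 => ay.
have vy u : e <= `|v u| -> e <= normc (y -i* v u).
  by move=> /le_trans; apply; have := normr_Im_le (y -i* v u); rewrite /= normrN.
pose q u := (e / 2)%:C * (y -i* v u)^-1.
have aq : outer_approx q by apply: outer_approxM => //; exact: outer_approx_cst.
have q2 u : e <= `|v u| -> normc (q u) <= 1 / 2.
  move=> eu; have evy := vy _ eu.
  rewrite normcM normcV normc_real gtr0_norm ?divr_gt0//.
  rewrite ler_pdivrMr ?(lt_le_trans e0)//; lra.
have half1 : (1 / 2 : R) < 1 by lra.
have half0 : 0 <= (1 / 2 : R) by lra.
apply: outer_approx_eq (outer_approxM ay (outer_approx_neumann aq half0 half1 q2)) _.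
move=> u eu; rewrite -invfM; congr (_^-1).
have yv : y -i* v u != 0 :> R[i].
  by apply: contraTneq (vy _ eu) => ->; rewrite normc0 -ltNge.
rewrite /q mulrBr mulr1 mulrCA divff// mulr1.
by apply/eqP; rewrite eq_complex /= subr0 eqxx andbT /y addrK.
Qed.

End slab.

(** * Approximating one along a single direction *)

Section directional.
Context {R : realType} {d : nat}.
Variables (b u0 : 'rV[R]_d) (e r : R).
Hypotheses (e0 : 0 < e) (r0 : 0 < r).
Implicit Types (u : 'rV[R]_d) (w p : 'rV[R]_d -> R[i]).

Let v u := dotr b (u - u0).
Let L := line b setT.

Let L0 : L 0. Proof. exact: line0. Qed.

Let LD x y : L x -> L y -> L (x + y).
Proof. exact: lineD. Qed.

(** For [z < 0] the direction is reversed: up to sign, this is the resolvent of [- b] at [- z], and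
    [L] contains both half-lines. *)
Lemma bclosure_resolvent (z : R) : z != 0 -> bclosure L (fun u => (z -i* v u)^-1).
Proof.
rewrite neq_lt => /orP[z0|z0]; last first.
  apply: bclosure_sub (bclosure_resolvent_gt0 b u0 z0).
  by move=> _ [t _ <-]; exists t.
rewrite -oppr_gt0 in z0.
have := bclosureZ (-1) (bclosure_resolvent_gt0 (- b) u0 z0).
move=> /(@bclosure_sub _ _ _ L) h.
apply: bclosure_eq (h _) _.
  by move=> _ [t _ <-]; exists (- t) => //; rewrite scaleNr scalerN.
move=> u; rewrite mulN1r -invrN; congr (_^-1).
by rewrite /v dotrNl; apply/eqP; rewrite eq_complex /= !opprK !eqxx.
Qed.

(** A Lorentzian in [v], equal to [- e^2 / ((e - iv)(-e - iv))] and hence built from two resolvents;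
    it is at least 1/2 exactly on the slab [|v| <= e]. *)
Let bump u : R := e ^+ 2 / (e ^+ 2 + v u ^+ 2).

Let bump_den u : 0 < e ^+ 2 + v u ^+ 2.
Proof. by rewrite ltr_pwDl ?exprn_gt0// sqr_ge0. Qed.

Let bclosure_bump : bclosure L (fun u => (bump u)%:C).
Proof.
have h := bclosureM LD (bclosure_resolvent (lt0r_neq0 e0))
  (bclosure_resolvent (_ : - e != 0)).
have {}h := h _; rewrite oppr_eq0 lt0r_neq0// in h.
apply: bclosure_eq (bclosureZ (- (e ^+ 2)%:C) (h isT)) _ => u.
rewrite -invfM.
have -> : (e -i* v u) * (- e -i* v u) = - (e ^+ 2 + v u ^+ 2)%:C.
  by apply/eqP; rewrite eq_complex /=; apply/andP; split; apply/eqP; ring.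
by rewrite invrN mulrNN -fmorphV -rmorphM.
Qed.

(** The limit in [cvg_threshold], taken at [bump], is the indicator of the complement of the slab;
    its value 0 at the threshold makes the slab closed. *)
Lemma bclosure_cutoff : bclosure L (fun u => (`|v u| <= e)%R%:R).
Proof.
apply: (bclosure_lim
  (w_ := fun n u => 1 - (1 - (bump u)%:C ^+ n) ^+ (n * 2 ^ n)) (C := 1)).
- move=> n; apply: (bclosureB (bclosure1 L0)).
  by apply/(bclosureX _ L0 LD)/bclosureB; [exact: bclosure1|exact: bclosureX].
- move=> n u.
  have b0 : 0 <= bump u by rewrite divr_ge0 ?sqr_ge0// ltW.
  have b1 : bump u <= 1 by rewrite ler_pdivrMr// mul1r lerDl sqr_ge0.
  rewrite -rmorphXn -(rmorphB _ 1) -rmorphXn -(rmorphB _ 1) normc_real ger0_norm.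
    by rewrite gerBl exprn_ge0// subr_ge0 exprn_ile1.
  rewrite subr_ge0 exprn_ile1// ?subr_ge0 ?exprn_ile1// gerBl exprn_ge0//.
- move=> u.
  have b0 : 0 <= bump u by rewrite divr_ge0 ?sqr_ge0// ltW.
  have b1 : bump u <= 1 by rewrite ler_pdivrMr// mul1r lerDl sqr_ge0.
  have be : (bump u < 1 / 2) = ~~ (`|v u| <= e).
    rewrite -ltNge ltr_pdivrMr// -(@ltr_pXn2r _ 2 _ e) ?nnegrE ?normr_ge0 ?(ltW e0)//.
    rewrite real_normK ?num_real//; apply/idP/idP; lra.
  have := cvg_threshold b0 b1; rewrite be.
  set c : R := if _ then _ else _ => h.
  have -> : (`|v u| <= e)%R%:R = 1 + - c%:C :> R[i].
    by rewrite /c; case: (`|v u| <= e) => /=; rewrite ?subr0 ?subrr.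
  apply: ccvgD; first exact: ccvg_cst.
  apply: (@ccvg_le _ (fun n => `|c - (1 - bump u ^+ n) ^+ (n * 2 ^ n)|)).
    near=> n; rewrite (_ : _ - _ = (c - (1 - bump u ^+ n) ^+ (n * 2 ^ n))%:C) ?normc_real//.
    by rewrite rmorphB rmorphXn rmorphB rmorph1 rmorphXn; ring.
  rewrite -(@normr0 _ R); apply: cvg_norm.
  rewrite -[X in _ --> X](subrr c).
  by apply: cvgB => //; exact: cvg_cst.
Unshelve. all: by end_near. Qed.

(** The functions [phi n = (1 + irv/(n+1))^-(n+1)] tend to [exp(-irv)], so [g n] tends to one while
    keeping the explicit factor [exp(irv)]. *)
Let a n : R := r / n.+1%:R.
Let phi n u : R[i] := (1 +i* (a n * v u))^-1 ^+ n.+1.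
Let g n u : R[i] := expi (r * v u) * phi n u.

Let a_gt0 n : 0 < a n. Proof. by rewrite divr_gt0. Qed.

(** The factor is a resolvent with parameter [- 1/a < 0]: its pole lies in the upper half-plane, and
    has to be moved before one-sided frequencies can be used. *)
Let inv1iE n u : (1 +i* (a n * v u))^-1 = (- (a n)^-1)%:C * (- (a n)^-1 -i* v u)^-1 :> R[i].
Proof.
have a0 := lt0r_neq0 (a_gt0 n).
rewrite -[(- (a n)^-1)%:C]invrK -invfM; congr (_^-1).
rewrite -fmorphV invrN invrK.
by apply/eqP; rewrite eq_complex /=; apply/andP; split; apply/eqP; field.
Qed.

Let normc_inv1i_le1 (y : R) : normc (1 +i* y)^-1 <= 1.
Proof.
have h : 1 <= normc (1 +i* y) by have := normr_Re_le (1 +i* y); rewrite normr1.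
by rewrite normcV invf_le1// (lt_le_trans ltr01 h).
Qed.

Let normc_phi_le1 n u : normc (phi n u) <= 1.
Proof. by rewrite normcX exprn_ile1// normc_ge0. Qed.

(** By [normc_subXX_le] the error is at most [n + 1] times the quadratic error [2 (rv/(n+1))^2] of a
    single factor. *)
Let g_cvg1 u : ccvg (g ^~ u) 1.
Proof.
apply: (@ccvg_le _ (fun n => 2 * (r * v u) ^+ 2 * harmonic n)); last first.
  by rewrite -(mulr0 (2 * (r * v u) ^+ 2)); apply: cvgMr; exact: cvg_harmonic.
near=> n; have -> : g n u - 1 = expi (r * v u) * (phi n u - expi (- (a n * v u)) ^+ n.+1).
  rewrite mulrBr -expiMn -expiD; congr (_ - _); rewrite -expi0; congr expi.
  by rewrite /a -mulr_natr; field.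
rewrite normcM normc_expi mul1r (le_trans (normc_subXX_le _ _ _))// ?normc_expi//.
(* A common denominator makes the exponential remainder appear; the other factors have modulus at
   most one. *)
have -> : (1 +i* (a n * v u))^-1 - expi (- (a n * v u)) =
    (expi (a n * v u) - (1 +i* (a n * v u))) * (expi (- (a n * v u)) * (1 +i* (a n * v u))^-1).
  have i0 : (1 +i* (a n * v u)) != 0 :> R[i].
    by rewrite eq_complex /= negb_and oner_eq0.
  rewrite mulrBl mulrA -expiD subrr expi0 mul1r mulrCA divff// mulr1 //.
rewrite normcM normcM normc_expi mul1r.
apply: (@le_trans _ _ (n.+1%:R * (2 * (a n * v u) ^+ 2))).
  rewrite ler_wpM2l// -[leRHS]mulr1 ler_pM ?normc_ge0// normc_expi_sub//.
by rewrite le_eqVlt /harmonic /a; apply/orP; left; apply/eqP => /=; field.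
Unshelve. all: by end_near. Qed.

(** Multiplying the Runge approximant of [phi n] by [exp(irv)] pushes its frequencies to [t <= - r].
    Outside the slab the resulting [p] alone is close to [g n]; inside, [k] is the exact difference,
    cut off to the slab. *)
Lemma directional_approx n : exists p k : 'rV[R]_d -> R[i],
  [/\ bclosure (line b [set t | t <= - r]) p, bclosure L k,
      forall u, e < `|v u| -> k u = 0 &
      forall u, normc (k u + p u - g n u) <= harmonic n].
Proof.
have /(_ (harmonic n) (harmonic_gt0 n))[p Xp pphi] : outer_approx b u0 e (phi n).
  apply: outer_approxX; under eq_fun do rewrite inv1iE.
  by apply: outer_approxM; [exact: outer_approx_cst|exact: outer_approx_resolvent].
have Lr : bclosure (line b [set t | t = - r]) (fun u => expi (r * v u)) by exact: bclosure_expi.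
have Lphi : bclosure L (phi n).
  apply: (bclosureX _ L0 LD); under eq_fun do rewrite inv1iE.
  apply: bclosureZ; apply: bclosure_resolvent.
  by rewrite oppr_eq0 invr_eq0 lt0r_neq0.
pose P u := expi (r * v u) * p u.
have XP : bclosure (line b [set t | t <= - r]) P.
  by apply: bclosureM Lr Xp; apply: lineD => s t /= ->; lra.
have LP : bclosure L P by apply: bclosure_sub XP => _ [t _ <-]; exists t.
have Lg : bclosure L (g n) by apply: bclosureM Lr Lphi; exact: lineD.
exists P, (fun u => (g n u - P u) * (`|v u| <= e)%R%:R); split=> //.
- by apply: bclosureM LD _ bclosure_cutoff; exact: bclosureB.
- by move=> u; rewrite ltNge => /negPf ->; rewrite mulr0.
- move=> u; have [vu|vu] := leP `|v u| e.
    by rewrite mulr1 subrK subrr normc0 ltW// harmonic_gt0.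
  rewrite mulr0 add0r normcB_sym /g /P -mulrBr normcM normc_expi mul1r.
  exact/pphi/ltW.
Qed.

Lemma directional_approx_one : exists p k : nat -> 'rV[R]_d -> R[i],
  [/\ forall n, bclosure (line b [set t | t <= - r]) (p n), forall n, bclosure L (k n),
      forall n u, e < `|v u| -> k n u = 0,
      forall n u, normc (k n u + p n u) <= 2 &
      forall u, ccvg (fun n => k n u + p n u) 1].
Proof.
have /choice[p /choice[k pkP]] := directional_approx.
exists p, k; split=> [n|n|n|n u|u]; try by have [] := pkP n.
  (* The bound 2 is [|g n| <= 1] plus an error [harmonic n <= 1]. *)
  have [_ _ _ /(_ u) h] := pkP n; rewrite -(subrK (g n u) (_ + _)).
  rewrite (le_trans (le_normcD _ _))// [leRHS](_ : _ = 1 + 1) // lerD//.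
    by rewrite (le_trans h)// /harmonic /= invf_le1 ?ler1n.
  by rewrite normcM normc_expi mul1r.
rewrite [X in ccvg X](_ : _ = fun n => k n u + p n u - g n u + g n u); last first.
  by apply/funext => n; rewrite subrK.
rewrite -[X in ccvg _ X]add0r; apply: ccvgD => //.
apply: (@ccvg_le _ harmonic); last exact: cvg_harmonic.
by near=> n; rewrite subr0; have [] := pkP n.
Unshelve. all: by end_near. Qed.

End directional.

(** * Approximating one off a box *)

Section box.
Context {R : realType} {d m : nat}.
Variables (b a : 'I_m -> 'rV[R]_d) (u0 : 'rV[R]_d) (e r : R).
Hypotheses (e0 : 0 < e) (r0 : 0 < r).
Hypothesis dual : forall i j, dotr (a i) (b j) = (i == j)%:R.

(* On [\prod_i (k_i + p_i) - \prod_i k_i] every term contains some [p_i], while the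
   second product vanishes off the box. *)
Lemma box_approx_one : exists (W : nat -> 'rV[R]_d -> R[i]) (C : R),
  [/\ forall n, bclosure [set x | exists i, dotr (a i) x <= - r] (W n),
      forall n u, (exists i, e < `|dotr (b i) (u - u0)|) -> normc (W n u) <= C &
      forall u, (exists i, e < `|dotr (b i) (u - u0)|) -> ccvg (W ^~ u) 1].
Proof.
have /choice[p /choice[k pk]] := fun i => directional_approx_one (b i) u0 e0 r0.
pose A (s : seq 'I_m) n u := \prod_(i <- s) (k i n u + p i n u).
pose K (s : seq 'I_m) n u := \prod_(i <- s) k i n u.
(* The frequencies of a product over [s] are combinations of the [b i] with [i] in [s], so by
   duality every other [a j] annihilates them. *)
pose Z (s : seq 'I_m) := [set x | forall j, j \notin s -> dotr (a j) x = 0].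
pose N (s : seq 'I_m) := [set x | exists2 i, i \in s & dotr (a i) x <= - r].
have AZ s n : bclosure (Z s) (A s n).
  rewrite /A; elim: s => [|i s ih].
    under eq_fun do rewrite big_nil; apply: bclosure1 => j _.
    by rewrite dotrC dotr0l.
  under eq_fun do rewrite big_cons.
  have [ip ik _ _ _] := pk i.
  have aik : bclosure (line (b i) setT) (fun u => k i n u + p i n u).
    by apply: bclosureD => //; apply: bclosure_sub (ip n) => _ [t _ <-]; exists t.
  apply: bclosureM aik ih => _ y [t _ <-] Zy j; rewrite in_cons negb_or => /andP[ji js].
  by rewrite dotrDr dotrZr dual (negPf ji) mulr0 add0r Zy.
have AK s n : uniq s -> bclosure (N s) (fun u => A s n u - K s n u).
  rewrite /A /K; elim: s => [_|i s ih /= /andP[si us]].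
    by apply: bclosure_eq (bclosure0 _) _ => u; rewrite !big_nil subrr.
  have [ip ik _ _ _] := pk i.
  (* For [i :: s] the difference is [p_i A_s + k_i (A_s - K_s)]. In the first term [a i] sees only
     the frequency of [p_i], as [i] is not in [s]; in the second the index [j] given by induction
     differs from [i], so [k_i] does not affect [a j]. *)
  have h1 : bclosure (N (i :: s)) (fun u => p i n u * A s n u).
    apply: bclosureM (ip n) (AZ s n) => _ y [t /= tr <-] Zy; exists i; first exact: mem_head.
    by rewrite dotrDr dotrZr dual eqxx mulr1 Zy// addr0.
  have h2 : bclosure (N (i :: s)) (fun u => k i n u * (A s n u - K s n u)).
    apply: bclosureM (ik n) (ih us) => _ y [t _ <-] [j js ajy].
    exists j; first by rewrite in_cons js orbT.
    rewrite dotrDr dotrZr dual (negPf (memPn si _ _)) ?mulr0 ?add0r//.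
  apply: bclosure_eq (bclosureD h1 h2) _ => u.
  by rewrite !big_cons /A /K; ring.
have K0 n u : (exists i, e < `|dotr (b i) (u - u0)|) -> K (enum 'I_m) n u = 0.
  move=> [i ei]; have [_ _ /(_ n u ei) ki0 _ _] := pk i.
  by rewrite /K (big_rem i) ?mem_enum//= ki0 mul0r.
exists (fun n u => A (enum 'I_m) n u - K (enum 'I_m) n u), (2 ^+ m); split.
- move=> n; apply: bclosure_sub (AK _ n (enum_uniq _)) => x [i _ aix]; by exists i.
- move=> n u /(K0 n) ->; rewrite subr0 /A -[X in 2 ^+ X](size_enum_ord m).
  elim: (enum 'I_m) => [|i s ih]; first by rewrite big_nil normc1 expr0.
  rewrite big_cons normcM exprS ler_pM ?normc_ge0//.
  by have [] := pk i.
- move=> u ei; under eq_fun do rewrite K0// subr0.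
  have -> : 1 = \prod_(i <- enum 'I_m) 1 :> R[i] by rewrite big1_eq.
  apply: ccvg_prod => i.
  by have [] := pk i.
Qed.

End box.

(** * Cones *)

Section euclidean_geometry.
Context {R : realType} {d : nat}.
Implicit Types (x y w e : 'rV[R]_d) (B : set 'rV[R]_d).

Lemma dotr_continuous (f g : 'rV[R]_d -> 'rV[R]_d) : continuous f -> continuous g ->
  continuous (fun x => dotr (f x) (g x)).
Proof.
move=> cf cg; apply: continuous_big => [|i _]; first exact: add_continuous.
have cc (h : 'rV[R]_d -> 'rV[R]_d) : continuous h -> continuous (fun x => h x ord0 i : R).
  move=> ch x; apply: (@continuous_comp _ _ _ h (fun y : 'rV[R]_d => y ord0 i : R)).
    exact: ch.
  exact: coord_continuous.
by move=> x; exact: (cvgM (cc _ cf x) (cc _ cg x)).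
Qed.

Lemma ler_coord_norm x i : `|x ord0 i| <= `|x|.
Proof.
rewrite [leRHS]/Num.norm /= mx_normrE; apply/bigmax_geP; right => /=.
by exists (ord0, i).
Qed.

Lemma norm_rV_le x (c : R) : 0 <= c -> (forall i, `|x ord0 i| <= c) -> `|x| <= c.
Proof.
move=> c0 xc; rewrite [leLHS]/Num.norm /= mx_normrE; apply/bigmax_leP; split=> // -[i j] _ /=.
by rewrite ord1.
Qed.

Lemma dotr_ge0 x : 0 <= dotr x x.
Proof. by apply: sumr_ge0 => i _; rewrite -expr2 sqr_ge0. Qed.

Lemma sqr_coord_le x i : x ord0 i ^+ 2 <= dotr x x.
Proof.
rewrite /dotr (bigD1 i)//= -expr2 lerDl sumr_ge0// => j _.
by rewrite -expr2 sqr_ge0.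
Qed.

Lemma dotr_eq0 x : dotr x x = 0 -> x = 0.
Proof.
move=> xx0; apply/rowP => i; rewrite mxE; apply/eqP.
by rewrite -sqrf_eq0 eq_le sqr_ge0 andbT -xx0 sqr_coord_le.
Qed.

Lemma dotr_gt0 x : x != 0 -> 0 < dotr x x.
Proof.
move=> x0; rewrite lt_neqAle dotr_ge0 andbT eq_sym.
by apply: contra x0 => /eqP/dotr_eq0 ->.
Qed.

Lemma norm_rV_le_dotr x : `|x| <= 1 + dotr x x.
Proof.
apply: norm_rV_le => [|i]; first by rewrite addr_ge0// dotr_ge0.
have := sqr_coord_le x i; rewrite -real_normK ?num_real//.
by have := sqr_ge0 (`|x ord0 i| - 1); rewrite sqrrB expr1n mulr1; have := dotr_ge0 x; lra.
Qed.

(** The minimum is sought among the points of [B] no farther than a given one, a compact set. *)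
Lemma closest_point B x : closed B -> B !=set0 ->
  exists2 y, B y & forall z, B z -> dotr (x - y) (x - y) <= dotr (x - z) (x - z).
Proof.
move=> cB [y0 By0]; pose q y := dotr (x - y) (x - y).
have cq : continuous q.
  have c : continuous (fun y : 'rV[R]_d => x - y).
    by move=> y; apply: (@continuousB _ _ _ (fun=> x) id); [exact: cst_continuous|exact: cvg_id].
  exact: dotr_continuous.
pose A := B `&` q @^-1` [set t | t <= q y0].
have cA : compact A.
  apply: bounded_closed_compact.
    exists (`|x| + (1 + q y0)); split; first by rewrite num_real.
    move=> M hM y [_ /= qy]; apply: le_trans (ltW hM).
    rewrite -[y](subKr x) (le_trans (ler_normB _ _))// lerD2l.
    by rewrite (le_trans (norm_rV_le_dotr _))// lerD2l.
  apply: closedI => //; apply: closed_comp => [y _|]; first exact: cq.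
  exact: closed_le.
have A0 : A !=set0 by exists y0; split => /=.
have [y /set_mem[By qy] ymin] := EVT_min_rV A0 cA (continuous_subspaceT cq).
exists y => // z Bz; have [zy0|/ltW zy0] := leP (q z) (q y0).
  by apply: ymin; rewrite inE.
exact: le_trans qy zy0.
Qed.

(** * Separation and dual bases for a strictly convex cone *)

Section cone.
Variable B : set 'rV[R]_d.
Hypothesis cone : closed_strictly_convex_cone B.

(** The sum is twice the midpoint. *)
Lemma coneD x y : B x -> B y -> B (x + y).
Proof.
move=> Bx By; have h0 : 0 <= (2^-1 : R) by rewrite invr_ge0.
have h1 : (2^-1 : R) <= 1 by lra.
pose p : {i01 R} := Itv01 h0 h1.
have h := set_mem (cone_convex cone p (mem_set Bx) (mem_set By)).
have := cone_scale cone (ler0n _ 2) h.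
congr (B _); rewrite [X in _ *: X](_ : _ = 2^-1 *: x + (1 - 2^-1) *: y)//.
rewrite scalerDr !scalerA divff// scale1r; congr (_ + _).
by rewrite mulrBr mulr1 divff// (_ : 2 - 1 = 1 :> R) ?scale1r//; lra.
Qed.

Definition dual_cone : set 'rV[R]_d := [set e | forall x, B x -> 0 <= dotr e x].

(* [e = x + y] with [y] the projection of [-x] on the cone. *)
Lemma dual_cone_separates x : B x -> x != 0 -> exists2 e, dual_cone e & 0 < dotr e x.
Proof.
move=> Bx x0.
have [y By ymin] := closest_point (- x) (cone_closed cone) (ex_intro _ x Bx).
pose e := x + y.
have exp z t : dotr (- x - (y + t *: z)) (- x - (y + t *: z)) =
    dotr e e + t * (2 * dotr e z + t * dotr z z).
  rewrite opprD addrA -opprD -/e -opprD dotrNl dotrNr opprK; move: (e) => g.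
  by rewrite dotrDl !dotrDr !dotrZl !dotrZr (dotrC z g); ring.
(* Minimality of [y], tested at the competitor [y + t z]. *)
have min z t : B (y + t *: z) -> 0 <= t * (2 * dotr e z + t * dotr z z).
  move=> /ymin; rewrite exp -opprD -/e dotrNl dotrNr opprK.
  by rewrite lerDl.
have aux z : (forall t, 0 < t -> t <= 1 -> B (y + t *: z)) -> 0 <= dotr e z.
  move=> Bz; rewrite leNgt; apply/negP => ez.
  have D0 : 0 < 1 + dotr z z by rewrite ltr_wpDr// dotr_ge0.
  (* Chosen so that [t (1 + z.z) <= - e.z], whence [2 e.z + t z.z <= e.z - t < 0], against
     minimality. *)
  pose t := Num.min 1 (- dotr e z / (1 + dotr z z)).
  have t0 : 0 < t by rewrite lt_min ltr01 divr_gt0// oppr_gt0.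
  have t1 : t <= 1 by rewrite ge_min lexx.
  have := min z t (Bz t t0 t1); rewrite pmulr_rge0//.
  have : t * (1 + dotr z z) <= - dotr e z.
    by rewrite -ler_pdivlMr// ge_min lexx orbT.
  have : 0 <= t * 1 by rewrite mulr1 ltW.
  by lra.
have eB : dual_cone e.
  move=> z Bz; apply: aux => t t0 _; apply: coneD => //.
  exact: (cone_scale cone (ltW t0)).
(* Shrinking [y] towards 0 stays in the cone, so [e.y <= 0]; this yields
   [e.x = e.e - e.y >= e.e]. *)
have ey : 0 <= dotr e (- y).
  apply: aux => t t0 t1; rewrite scalerN -[X in X - _]scale1r -scalerBl.
  by apply: (cone_scale cone) => //; rewrite subr_ge0.
exists e => //.
(* If [e = 0] then [y = - x], which strictness excludes. *)
have e0 : e != 0.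
  apply/eqP => /eqP; rewrite /e addr_eq0 => /eqP xy.
  apply: (cone_strict cone x0); split => //.
  by rewrite xy opprK.
have := dotr_gt0 e0; rewrite {2}/e dotrDr; rewrite dotrNr in ey; lra.
Qed.

(** Produces an interior vector of the dual cone. The half-spaces [e'.x > 0], for [e'] in the dual
    cone, cover the compact unit section of [B]; the vectors of a finite subcover are summed, and
    the minimum on the section extends by homogeneity. *)
Lemma dual_cone_interior : exists e (c : R), 0 < c /\
  forall x i, B x -> c * `|x ord0 i| <= dotr e x.
Proof.
pose K := B `&` [set x | dotr x x = 1].
have cid : continuous (fun x : 'rV[R]_d => x) by move=> x; exact: cvg_id.
have cK : compact K.
  apply: bounded_closed_compact.
    exists 2; split; first by rewrite num_real.
    move=> M hM x [_ /= x1]; apply: le_trans (ltW hM).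
    by apply: (le_trans (norm_rV_le_dotr _)); rewrite x1.
  apply: closedI; first exact: cone_closed cone.
  apply: (@closed_comp _ _ (fun x : 'rV[R]_d => dotr x x) [set 1]) => [y _|].
    exact: dotr_continuous.
  exact: closed_eq.
have K0 x : K x -> x != 0.
  by move=> [_ /= x1]; apply/eqP => x0; move: x1; rewrite x0 dotr0l => /esym/eqP; rewrite oner_eq0.
have [e eB eK] : exists2 e, dual_cone e & forall x, K x -> 0 < dotr e x.
  have := cK; rewrite compact_cover => /(_ _ dual_cone (fun e => [set x | 0 < dotr e x])).
  case=> [e _|x Kx|D' D'B KD'].
  - apply: (@open_comp _ _ (dotr e) [set t | 0 < t]) => [y _|]; last exact: open_gt.
    by apply: dotr_continuous => //; exact: cst_continuous.
  - by have [e ? ?] := dual_cone_separates Kx.1 (K0 x Kx); exists e.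
  exists (\sum_(e <- D') e).
    move=> x Bx; rewrite dotrC big_seq; elim/big_ind : _ => [|a b a0 b0|e eD'].
    - by rewrite dotrC dotr0l.
    - by rewrite dotrDr addr_ge0.
    - by rewrite dotrC; exact: (set_mem (D'B _ eD')).
  move=> x Kx; have [e /= eD' ex] := KD' x Kx.
  rewrite (big_fsetD1 e)//= dotrDl ltr_wpDr//.
  rewrite big_seq dotrC; elim/big_ind : _ => [|a b a0 b0|e'].
  - by rewrite dotrC dotr0l.
  - by rewrite dotrDr addr_ge0.
  - rewrite in_fsetD1 => /andP[_ eD'']; rewrite dotrC.
    by apply: (set_mem (D'B _ eD'')); exact: Kx.1.
have [c c0 cK1] : exists2 c : R, 0 < c & forall x, K x -> c <= dotr e x.
  (* The section is empty when [B] has no nonzero vector; any positive constant then serves. *)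
  have [nK|/set0P nK] := eqVneq K set0; first by exists 1 => // x; rewrite nK.
  have ce : continuous (dotr e).
    by apply: dotr_continuous => //; exact: cst_continuous.
  have [x /set_mem Kx xmin] := EVT_min_rV nK cK (continuous_subspaceT ce).
  by exists (dotr e x) => [|z Kz]; [exact: eK|apply: xmin; rewrite inE].
exists e, c; split=> // x i Bx; have [->|x0] := eqVneq x 0.
  by rewrite mxE normr0 mulr0 dotrC dotr0l.
pose n := Num.sqrt (dotr x x).
have n0 : 0 < n by rewrite sqrtr_gt0 dotr_gt0.
have n2 : n * n = dotr x x by rewrite -expr2 sqr_sqrtr// dotr_ge0.
have : K (n^-1 *: x).
  split; first by apply: (cone_scale cone) => //; rewrite invr_ge0 ltW.
  by rewrite /= dotrZl dotrZr -n2; field; rewrite gt_eqF.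
move=> /cK1; rewrite dotrZr mulrC ler_pdivlMr//; apply: le_trans.
rewrite ler_wpM2l ?(ltW c0)// -[leRHS]gtr0_norm//.
by rewrite -ler_sqr ?nnegrE ?normr_ge0// !real_normK ?num_real// [n ^+ 2]expr2 n2 sqr_coord_le.
Qed.

(* [a i = e + s *: delta_i], whose dual basis is explicit by the
   Sherman-Morrison formula. *)
Lemma dual_bases : exists a b : 'I_d -> 'rV[R]_d,
  [/\ forall i, dual_cone (a i), forall i j, dotr (a i) (b j) = (i == j)%:R &
      forall w, w = \sum_i dotr (b i) w *: a i].
Proof.
have [e [c [c0 ec]]] := dual_cone_interior.
pose D := \sum_i e ord0 i.
(* [|s| = c] keeps every [a i] in the dual cone; the sign of [s] agrees with that of [D], so that
   the denominator [s + D] does not vanish. *)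
have [s [sc s0 sD]] : exists s, [/\ `|s| = c, s != 0 & s + D != 0].
  have [D0|D0] := leP 0 D.
    by exists c; rewrite gtr0_norm// !gt_eqF// ltr_pwDl.
  exists (- c); rewrite normrN gtr0_norm// oppr_eq0 gt_eqF//; split=> //.
  by rewrite lt_eqF//; lra.
pose one : 'rV[R]_d := const_mx 1.
pose del i : 'rV[R]_d := delta_mx 0 i.
have dot1 x : dotr one x = \sum_i x ord0 i.
  by apply: eq_bigr => i _; rewrite mxE mul1r.
have dotd i x : dotr (del i) x = x ord0 i.
  rewrite /dotr (bigD1 i)//= mxE !eqxx mul1r big1 ?addr0// => j ji.
  by rewrite mxE (negPf ji) andbF mul0r.
pose a i := e + s *: del i.
pose b j := s^-1 *: (del j - (e ord0 j / (s + D)) *: one).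
exists a, b; split.
- move=> i x Bx; rewrite /a dotrDl dotrZl dotd.
  have := ec x i Bx; have : - (s * x ord0 i) <= c * `|x ord0 i|.
    by rewrite -sc -normrM -normrN ler_norm.
  lra.
- move=> i j; rewrite /a /b dotrZr dotrDl dotrZl dotd (dotrC e) dotrDl dotrNl dotrZl dotd dot1.
  rewrite -/D !mxE eqxx /= (eq_sym i).
  by move: (_ == _)%:R (e _ _) => t f; field; rewrite s0 sD.
- move=> w; pose W := \sum_i w ord0 i.
  have bw i : dotr (b i) w = s^-1 * (w ord0 i - e ord0 i / (s + D) * W).
    by rewrite /b dotrZl dotrDl dotrNl dotrZl dotd dot1.
  apply/rowP => k; rewrite summxE.
  under eq_bigr do rewrite bw !mxE eqxx /= mulrDr.
  rewrite big_split /= -mulr_suml -mulr_sumr.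
  rewrite [X in _ + X](bigD1 k)//= eqxx [X in _ + (_ + X)]big1 ?addr0; last first.
    by move=> i /negPf ik; rewrite eq_sym ik !mulr0.
  rewrite sumrB -!mulr_suml -/W -/D mulr1.
  have E (x : 'rV[R]_d) : x 0 k = x ord0 k by [].
  by rewrite !E; field; rewrite s0 sD.
Qed.

End cone.

End euclidean_geometry.

(** * Approximation in weighted [L^2] *)

Section complex_measurability.
Context {R : realType} {dT : measure_display} {T : measurableType dT}.
Implicit Types f g : T -> R[i].

Lemma cmeasurable_cst (c : R[i]) : cmeasurable_fun (fun _ : T => c).
Proof. by split; exact: measurable_cst. Qed.

Lemma cmeasurableD f g : cmeasurable_fun f -> cmeasurable_fun g ->
  cmeasurable_fun (fun t => f t + g t).
Proof.
move=> [f1 f2] [g1 g2]; split.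
  under eq_fun do rewrite raddfD; exact: measurable_funD.
under eq_fun do rewrite raddfD; exact: measurable_funD.
Qed.

Lemma cmeasurableM f g : cmeasurable_fun f -> cmeasurable_fun g ->
  cmeasurable_fun (fun t => f t * g t).
Proof.
have ReM (z w : R[i]) : complex.Re (z * w) =
    complex.Re z * complex.Re w - complex.Im z * complex.Im w by case: z; case: w.
have ImM (z w : R[i]) : complex.Im (z * w) =
    complex.Re z * complex.Im w + complex.Im z * complex.Re w by case: z; case: w.
move=> [f1 f2] [g1 g2]; split.
  by under eq_fun do rewrite ReM; apply: measurable_funB; exact: measurable_funM.
by under eq_fun do rewrite ImM; apply: measurable_funD; exact: measurable_funM.
Qed.

Lemma cmeasurableZ (c : R[i]) f : cmeasurable_fun f -> cmeasurable_fun (fun t => c * f t).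
Proof. exact/cmeasurableM/cmeasurable_cst. Qed.

Lemma cmeasurableB f g : cmeasurable_fun f -> cmeasurable_fun g ->
  cmeasurable_fun (fun t => f t - g t).
Proof.
move=> mf mg; under eq_fun do rewrite -[X in _ + X]mulN1r.
by apply: cmeasurableD => //; exact: cmeasurableZ.
Qed.

Lemma measurable_sqr_normc f : cmeasurable_fun f ->
  measurable_fun setT (fun t => normc (f t) ^+ 2).
Proof.
move=> [f1 f2]; under eq_fun do rewrite sqr_normcE.
by apply: measurable_funD; exact: measurable_funX.
Qed.

Lemma cmeasurable_expi (h : T -> R) : measurable_fun setT h ->
  cmeasurable_fun (fun t => expi (h t)).
Proof.
move=> mh; split=> /=.
  by apply: (measurableT_comp (f := @cos R)) => //;
    apply: continuous_measurable_fun; exact: continuous_cos.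
by apply: (measurableT_comp (f := @sin R)) => //;
  apply: continuous_measurable_fun; exact: continuous_sin.
Qed.

Lemma cmeasurable_cvg (f_ : nat -> T -> R[i]) f : (forall n, cmeasurable_fun (f_ n)) ->
  (forall t, ccvg (f_ ^~ t) (f t)) -> cmeasurable_fun f.
Proof.
move=> mf_ f_f; split.
  apply: (measurable_fun_cvg (h := fun n t => complex.Re (f_ n t))) => [n|t _].
    by have [] := mf_ n.
  apply/cvgrPdist_le => e e0; have /cvgrPdist_le/(_ e e0) := f_f t.
  apply: filterS => n; rewrite sub0r normrN ger0_norm ?normc_ge0// normcB_sym.
  by apply: le_trans; rewrite -raddfB normr_Re_le.
apply: (measurable_fun_cvg (h := fun n t => complex.Im (f_ n t))) => [n|t _].
  by have [] := mf_ n.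
apply/cvgrPdist_le => e e0; have /cvgrPdist_le/(_ e e0) := f_f t.
apply: filterS => n; rewrite sub0r normrN ger0_norm ?normc_ge0// normcB_sym.
by apply: le_trans; rewrite -raddfB normr_Im_le.
Qed.

End complex_measurability.

(** * Squared norms with a density *)

Section weighted_L2.
Context {R : realType} {dT : measure_display} {T : measurableType dT}.
Variables (mu : {measure set T -> \bar R}) (g : T -> R).
Hypotheses (g0 : forall t, 0 <= g t) (mg : measurable_fun setT g).
Implicit Types w : T -> R[i].

Definition wL2 w : \bar R := (\int[mu]_t (normc (w t) ^+ 2 * g t)%:E)%E.

Let measurable_integrand w : cmeasurable_fun w ->
  measurable_fun setT (fun t => (normc (w t) ^+ 2 * g t)%:E).
Proof.
move=> mw; apply/measurable_EFinP; apply: measurable_funM => //.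
exact: measurable_sqr_normc.
Qed.

Let integrand_ge0 w t : (0 <= (normc (w t) ^+ 2 * g t)%:E)%E.
Proof. by rewrite lee_fin mulr_ge0// sqr_ge0. Qed.

Lemma wL2_ge0 w : (0 <= wL2 w)%E.
Proof. exact: integral_ge0. Qed.

Lemma wL2Z (c : R[i]) w : cmeasurable_fun w ->
  wL2 (fun t => c * w t) = ((normc c ^+ 2)%:E * wL2 w)%E.
Proof.
move=> mw; rewrite /wL2 -ge0_integralZl ?lee_fin ?sqr_ge0//; last exact: measurable_integrand.
by apply: eq_integral => t _; rewrite normcM exprMn -mulrA EFinM.
Qed.

(** The factor 2 stands in for the triangle inequality, which avoids square roots. *)
Lemma wL2D w1 w2 : cmeasurable_fun w1 -> cmeasurable_fun w2 ->
  (wL2 (fun t => w1 t + w2 t)%R <= 2%:E * wL2 w1 + 2%:E * wL2 w2)%E.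
Proof.
move=> m1 m2; rewrite /wL2.
have mi1 := measurable_integrand m1; have mi2 := measurable_integrand m2.
rewrite -!ge0_integralZl// -ge0_integralD//; last 4 first.
- by move=> t _; rewrite mule_ge0.
- exact: measurable_funeM.
- by move=> t _; rewrite mule_ge0.
- exact: measurable_funeM.
apply: ge0_le_integral => //.
- by move=> t _; exact: (integrand_ge0 (fun t => w1 t + w2 t)).
- exact: (measurable_integrand (cmeasurableD m1 m2)).
- by apply: emeasurable_funD; exact: measurable_funeM.
move=> t _; rewrite -!EFinM -EFinD lee_fin.
have := ler_wpM2r (g0 t) (sqr_normcD_le (w1 t) (w2 t)).
by rewrite mulrDl -!mulrA.
Qed.

Hypothesis ig : (\int[mu]_t (g t)%:E < +oo)%E.

(** Dominated convergence with majorant [C^2 g]. The null set [N] makes room for the spectral gap,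
    where the approximants are not controlled. *)
Lemma wL2_dominated (w_ : nat -> T -> R[i]) (C : R) (N : set T) :
  measurable N -> mu N = 0%E ->
  (forall n, cmeasurable_fun (w_ n)) -> (forall n t, ~ N t -> normc (w_ n t) <= C) ->
  (forall t, ~ N t -> ccvg (w_ ^~ t) 0) ->
  (fun n => wL2 (w_ n)) @ \oo --> 0%E.
Proof.
move=> mN N0 mw wC w0.
have aeN (Q : T -> Prop) : (forall t, ~ N t -> Q t) -> {ae mu, forall t, Q t}.
  by move=> NQ; exists N; split => // t /= nQ; apply: contrapT => /NQ.
have igr : mu.-integrable setT (EFin \o g).
  apply/integrableP; split; first exact/measurable_EFinP.
  by under eq_integral do rewrite /= ger0_norm//.
have [] := @dominated_convergence _ _ _ mu setT measurableT
  (fun n t => (normc (w_ n t) ^+ 2 * g t)%:E) (cst 0%E) (fun t => (C ^+ 2)%:E * (g t)%:E)%E.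
- by move=> n; exact: measurable_integrand.
- exact: measurable_cst.
- apply: aeN => t Nt _; apply/fine_cvgP; split; first by near=> n.
  rewrite /comp /= -(mul0r (g t)); apply: cvgM; last exact: cvg_cst.
  have := w0 t Nt; rewrite /ccvg.
  under eq_fun do rewrite subr0.
  by move=> h; rewrite -(mulr0 (0 : R)); under eq_fun do rewrite expr2; exact: cvgM.
- exact: integrableZl.
- apply: aeN => t Nt n _; rewrite gee0_abs// -EFinM lee_fin ler_wpM2r//.
  by rewrite ler_pXn2r ?nnegrE ?normc_ge0 ?wC// (le_trans (normc_ge0 _) (wC n t Nt)).
- by move=> _ _; rewrite integral0.
Unshelve. all: by end_near. Qed.

End weighted_L2.

(** * From bounded limits to trigonometric polynomials *)

Section bclosure_L2.
Context {R : realType} {d : nat}.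
Implicit Types (X : set 'rV[R]_d) (w p : 'rV[R]_d -> R[i]).

Lemma measurable_dotr dT (T : measurableType dT) (f g : T -> 'rV[R]_d) :
  measurable_fun setT f -> measurable_fun setT g ->
  measurable_fun setT (fun u => dotr (f u) (g u)).
Proof.
move=> mf mg; apply: measurable_sum => i; apply: measurable_funM.
  exact: (measurableT_comp (measurable_coord_rV i)).
exact: (measurableT_comp (measurable_coord_rV i)).
Qed.

Lemma cmeasurable_character (x : 'rV[R]_d) : cmeasurable_fun (character x).
Proof.
apply: cmeasurable_expi; apply: measurableT_comp => //.
exact: measurable_dotr.
Qed.

Lemma bclosure_measurable X w : bclosure X w -> cmeasurable_fun w.
Proof.
elim=> [|x _|c w1 w2 _ m1 _ m2|w_ w' C _ m _ w_w].
- exact: cmeasurable_cst.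
- exact: cmeasurable_character.
- by apply: cmeasurableD => //; exact: cmeasurableZ.
- exact: cmeasurable_cvg w_w.
Qed.

Lemma trig_bclosure X p : trig X p -> bclosure X p.
Proof.
elim=> [|c x p' Xx _ h]; first exact: bclosure0.
by apply: bclosure_lin => //; exact: bclosure_char.
Qed.

Lemma trig_lin X c p q : trig X p -> trig X q -> trig X (fun u => c * p u + q u).
Proof.
move=> Xp Xq; elim: Xp => [|c' x p' Xx _ h].
  by under eq_fun do rewrite mulr0 add0r.
have := trig_add (c * c') Xx h; congr (trig X _); apply/funext => u; ring.
Qed.

Variables (mu : {measure set 'rV[R]_d -> \bar R}) (g : 'rV[R]_d -> R).
Hypotheses (g0 : forall t, 0 <= g t) (mg : measurable_fun setT g).
Hypothesis ig : (\int[mu]_t (g t)%:E < +oo)%E.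

(** Induction on [bclosure], with dominated convergence for the limits. The value at [u0] is tracked
    too, since the mean of a random measure acts as a point mass at the origin. *)
Lemma bclosure_wL2_trig X w u0 : bclosure X w -> forall e : R, 0 < e -> exists p,
  [/\ trig X p, (wL2 mu g (fun u => w u - p u)%R < e%:E)%E &
      normc (w u0 - p u0) ^+ 2 < e].
Proof.
elim=> [|x Xx|c w1 w2 X1 h1 X2 h2|w_ w' C Xw_ h wC w_w] e e0.
- exists (fun=> 0); split; first exact: trig0.
    rewrite /wL2; under eq_integral do rewrite subrr normc0 expr0n mul0r.
    by rewrite integral0 lte_fin.
  by rewrite subrr normc0 expr0n.
- exists (fun u => 1 * character x u + 0); split.
  + exact/trig_add/trig0.
  + rewrite /wL2; under eq_integral do rewrite mul1r addr0 subrr normc0 expr0n mul0r.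
    by rewrite integral0 lte_fin.
  + by rewrite mul1r addr0 subrr normc0 expr0n.
(* The [+ 1] guards against [c = 0]. With these tolerances each summand contributes at most [e/2],
   the second one strictly less. *)
- pose c2 := normc c ^+ 2 + 1.
  have c20 : 0 < c2 by rewrite ltr_wpDl// sqr_ge0.
  have [|p1 [tp1 l1 v1]] := h1 (e / 4 / c2); first by rewrite !divr_gt0.
  have [|p2 [tp2 l2 v2]] := h2 (e / 4); first by rewrite divr_gt0.
  have E u : c * w1 u + w2 u - (c * p1 u + p2 u) = c * (w1 u - p1 u) + (w2 u - p2 u).
    by ring.
  have m1 : cmeasurable_fun (fun u => w1 u - p1 u).
    apply: cmeasurableB; first exact: bclosure_measurable X1.
    exact: bclosure_measurable (trig_bclosure tp1).
  have m2 : cmeasurable_fun (fun u => w2 u - p2 u).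
    apply: cmeasurableB; first exact: bclosure_measurable X2.
    exact: bclosure_measurable (trig_bclosure tp2).
  have cc (y : R) : 0 <= y -> y < e / 4 / c2 -> 2 * (normc c ^+ 2 * y) <= e / 2.
    move=> y0 ye; have : normc c ^+ 2 * y <= c2 * (e / 4 / c2).
      by apply: ler_pM => //; [exact: sqr_ge0|rewrite lerDl|exact: ltW].
    rewrite mulrCA divff ?gt_eqF// mulr1; lra.
  exists (fun u => c * p1 u + p2 u); split; first exact: trig_lin.
  + under [X in wL2 _ _ X]eq_fun do rewrite E.
    apply: le_lt_trans (wL2D mu g0 mg (cmeasurableZ c m1) m2) _.
    rewrite (wL2Z mu g0 mg c m1).
    have := wL2_ge0 mu g0 (fun u => w1 u - p1 u)%R.
    have := wL2_ge0 mu g0 (fun u => w2 u - p2 u)%R.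
    move: l1 l2; case: (wL2 mu g _) => [y1||]//; case: (wL2 mu g _) => [y2||]//.
    rewrite -!EFinM -EFinD !lte_fin !lee_fin => ye1 ye2 y20 y10.
    by have := cc _ y10 ye1; lra.
  + rewrite E (le_lt_trans (sqr_normcD_le _ _))//.
    rewrite normcM exprMn; have := cc _ (sqr_ge0 _) v1; lra.
- have mw_ n : cmeasurable_fun (w_ n) := bclosure_measurable (Xw_ n).
  have mw' : cmeasurable_fun w' by exact: cmeasurable_cvg mw_ w_w.
  have Xw' : bclosure X w' := bclosure_lim Xw_ wC w_w.
  have [C' w'C] := bclosure_bounded Xw'.
  have e40 : 0 < e / 4 by rewrite divr_gt0.
  have l0 : (fun n => wL2 mu g (fun u => w' u - w_ n u)%R) @ \oo --> 0%E.
    apply: (@wL2_dominated _ _ _ mu g g0 mg ig _ (C' + C) set0) => //.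
    + by move=> n; exact: cmeasurableB.
    + by move=> n u _; rewrite (le_trans (le_normcD _ _))// normcN lerD.
    + move=> u _; have := w_w u; apply: ccvg_le.
      by near=> n; rewrite subr0 normcB_sym.
  have : \forall n \near \oo, (wL2 mu g (fun u => w' u - w_ n u)%R < (e / 4)%:E)%E /\
      normc (w_ n u0 - w' u0) ^+ 2 < e / 4.
    apply: filterI.
      by apply: (l0 [set y | (y < (e / 4)%:E)%E]); apply: open_ereal_lt'; rewrite lte_fin.
    have h2 : (fun n => normc (w_ n u0 - w' u0) ^+ 2) @ \oo --> (0 : R).
      rewrite -(mulr0 (0 : R)); under eq_fun do rewrite expr2.
      by apply: cvgM; exact: w_w.
    have /cvgr_dist_lt/(_ _ e40) := h2; apply: filterS => n.
    by rewrite sub0r normrN ger0_norm// sqr_ge0.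
  case=> n _ /(_ n (leqnn n))[ln vn].
  have [p [tp lp vp]] := h n (e / 4) e40.
  exists p; split=> //.
  + under [X in wL2 _ _ X]eq_fun => u do rewrite -(subrKA (w_ n u)).
    apply: le_lt_trans (wL2D mu g0 mg _ _) _; first exact: cmeasurableB.
      apply: cmeasurableB => //; exact: bclosure_measurable (trig_bclosure tp).
    have := wL2_ge0 mu g0 (fun u => w' u - w_ n u)%R.
    have := wL2_ge0 mu g0 (fun u => w_ n u - p u)%R.
    move: ln lp; case: (wL2 mu g _) => [y1||]//; case: (wL2 mu g _) => [y2||]//.
    rewrite -!EFinM -EFinD !lte_fin !lee_fin => ye1 ye2 y20 y10; lra.
  + rewrite -(subrKA (w_ n u0)) (le_lt_trans (sqr_normcD_le _ _))//.
    rewrite normcB_sym; lra.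
Unshelve. all: by end_near. Qed.

End bclosure_L2.

(** * Lebesgue measure and the Fourier transform *)

Section lebesgue_translation.
Context {R : realType}.

Lemma measurable_shift_rV n (x : 'rV[R]_n) : measurable_fun setT (fun y : 'rV[R]_n => y + x).
Proof.
apply: measurable_fun_rV => i; under eq_fun do rewrite mxE.
by apply: measurable_funD => //; exact: measurable_coord_rV.
Qed.

Lemma lebesgue_measure_shift (a : R) (A : set R) : measurable A ->
  pushforward (@lebesgue_measure R) (fun t : R => t + a : measurableTypeR R) A =
  lebesgue_measure A.
Proof.
move=> mA; have ms : measurable_fun setT (fun t : R => t + a : measurableTypeR R).
  exact: measurable_funD.
apply/esym/lebesgue_measure_unique => //=.
move=> _ [[x y] _ <-]; rewrite /pushforward /=.
have -> : (fun t : R => t + a) @^-1` `]x, y] = `](x - a), (y - a)]%classic.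
  by apply/seteqP; split=> t /=; rewrite !in_itv /= ltrBlDr lerBrDr.
rewrite !lebesgue_measure_itv /= !lte_fin ltrD2r.
by case: ifP => // _; rewrite -!EFinD; congr (_%:E); ring.
Qed.

(** Induction along the recursive construction: the induction hypothesis shifts each section, and
    one-dimensional invariance shifts the first coordinate. *)
Lemma lebesgue_rV_shift n (x : 'rV[R]_n) (A : set 'rV[R]_n) : measurable A ->
  lebesgue_rV R n ((fun y => y + x) @^-1` A) = lebesgue_rV R n A.
Proof.
elim: n x A => [|n ih] x A mA.
  congr (lebesgue_rV R 0 _); apply/seteqP; split=> y /=;
    by rewrite (_ : y + x = y)//; apply/rowP => -[].
rewrite /= /cons_measure /pushforward.
pose B := @cons_rV R n @^-1` A.
have mB : measurable B.
  by rewrite -[B]setTI; exact: measurable_cons_rV.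
pose x' : 'rV[R]_n := \row_i x ord0 (lift ord0 i).
pose phi t := lebesgue_rV R n (xsection B t).
have -> : @cons_rV R n @^-1` ((fun y => y + x) @^-1` A) =
    [set p | B (p.1 + x ord0 ord0, p.2 + x')].
  apply/seteqP; split=> -[t y] /=; rewrite /B /=; congr (A _); apply/rowP => i.
    by rewrite !mxE; case: unliftP => [j|] -> /=; rewrite ?mxE.
  by rewrite !mxE; case: unliftP => [j|] -> /=; rewrite ?mxE.
have mphi : measurable_fun setT phi by exact: measurable_fun_xsection.
transitivity (\int[@lebesgue_measure R]_t phi ((t : R) + x ord0 ord0)%R)%E.
  apply: eq_integral => t _ /=.
  rewrite /phi -(ih x' (xsection B _)); last exact: measurable_xsection.
  congr (lebesgue_rV R n _); apply/seteqP; split=> y /=; rewrite /xsection /= !inE//.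
transitivity (\int[pushforward (@lebesgue_measure R)
    (fun t : R => (t + x ord0 ord0)%R : measurableTypeR R)]_t phi t)%E.
  rewrite ge0_integral_pushforward//; exact: measurable_funD.
apply: eq_measure_integral => [|? C mC _]; first exact: measurable_funD.
exact: (lebesgue_measure_shift (x ord0 ord0) mC).
Qed.

End lebesgue_translation.

(** * Complex-valued integrals *)

Section complex_integral.
Context {R : realType} {dT : measure_display} {T : measurableType dT}.
Variable mu : {measure set T -> \bar R}.
Implicit Types f g : T -> R[i].

Definition cintegrable f :=
  mu.-integrable setT (fun t => (complex.Re (f t))%:E) /\
  mu.-integrable setT (fun t => (complex.Im (f t))%:E).

Let mulE (c z : R[i]) : c * z =
  (complex.Re c * complex.Re z - complex.Im c * complex.Im z) +i*
  (complex.Re c * complex.Im z + complex.Im c * complex.Re z).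
Proof. by case: c; case: z. Qed.

Let intZ (k : R) (h : T -> R) : mu.-integrable setT (fun t => (h t)%:E) ->
  mu.-integrable setT (fun t => (k * h t)%:E).
Proof. by move=> ih; under eq_fun do rewrite EFinM; exact: integrableZl. Qed.

Let intD (h k : T -> R) : mu.-integrable setT (fun t => (h t)%:E) ->
  mu.-integrable setT (fun t => (k t)%:E) -> mu.-integrable setT (fun t => (h t + k t)%:E).
Proof. by move=> ih ik; under eq_fun do rewrite EFinD; exact: integrableD. Qed.

Let intB (h k : T -> R) : mu.-integrable setT (fun t => (h t)%:E) ->
  mu.-integrable setT (fun t => (k t)%:E) -> mu.-integrable setT (fun t => (h t - k t)%:E).
Proof. by move=> ih ik; under eq_fun do rewrite EFinB; exact: integrableB. Qed.

Lemma cintegrableZ (c : R[i]) f : cintegrable f -> cintegrable (fun t => c * f t).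
Proof.
move=> [f1 f2]; split; under eq_fun do rewrite mulE /=.
  by apply: intB; exact: intZ.
by apply: intD; exact: intZ.
Qed.

Lemma cintegralZ (c : R[i]) f : cintegrable f ->
  cintegral mu (fun t => c * f t) = c * cintegral mu f.
Proof.
move=> [f1 f2]; rewrite [RHS]mulE /cintegral /=; congr (_ +i* _).
  under eq_Rintegral do rewrite mulE /=.
  by rewrite RintegralB ?RintegralZl//; exact: intZ.
under eq_Rintegral do rewrite mulE /=.
by rewrite RintegralD ?RintegralZl//; exact: intZ.
Qed.

Lemma cintegralD f g : cintegrable f -> cintegrable g ->
  cintegral mu (fun t => f t + g t) = cintegral mu f + cintegral mu g.
Proof.
move=> [f1 f2] [g1 g2]; rewrite /cintegral; apply/eqP; rewrite eq_complex /=.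
under eq_Rintegral do rewrite raddfD; rewrite RintegralD// eqxx /=.
by under eq_Rintegral do rewrite raddfD; rewrite RintegralD.
Qed.

Lemma cintegrable_bounded f (K : R) (A : set T) : cmeasurable_fun f ->
  measurable A -> (mu A < +oo)%E -> (forall t, normc (f t) <= K) ->
  (forall t, ~ A t -> f t = 0) -> cintegrable f.
Proof.
move=> [m1 m2] mA Aoo fK fA.
have aux (h : T -> R) : measurable_fun setT h -> (forall t, `|h t| <= normc (f t)) ->
    mu.-integrable setT (fun t => (h t)%:E).
  move=> mh hf.
  have iA : mu.-integrable A (EFin \o h).
    apply: measurable_bounded_integrable => //; first exact: measurable_funTS.
    exists K; split; first by rewrite num_real.
    by move=> k Kk t At /=; rewrite (le_trans (hf t))// (le_trans (fK t))// ltW.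
  have /(integrable_mkcond _ mA) := iA; congr (_.-integrable setT _).
  apply/funext => t; rewrite /patch; case: ifPn => //; rewrite notin_setE => /fA ft.
  by have := hf t; rewrite ft normc0 normr_le0 => /eqP ->.
by split; apply: aux => // t; [exact: normr_Re_le|exact: normr_Im_le].
Qed.

End complex_integral.

(** * Test functions and their Fourier transforms *)

Section Cbc_theory.
Context {R : realType} {d : nat}.
Implicit Types (f g : 'rV[R]_d -> R[i]) (x u : 'rV[R]_d) (B : set 'rV[R]_d).

Lemma Cbc_box f B : Cbc B f -> exists2 r : R, 0 < r & forall x, f x != 0 -> `|x| <= r.
Proof.
move=> [_ _ [r [_ fr]] _]; exists (`|r| + 1) => [|x fx]; first by rewrite ltr_wpDl.
by apply: fr => //; rewrite ltr_pwDr// ler_norm.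
Qed.

Lemma CbcW f A B : A `<=` B -> Cbc A f -> Cbc B f.
Proof. by move=> AB [m b s fA]; split => // x /fA/AB. Qed.

Lemma Cbc_subset f B : Cbc setT f -> (forall x, f x != 0 -> B x) -> Cbc B f.
Proof. by move=> [m b s _] fB; split. Qed.

Lemma Cbc0 B : Cbc B (fun=> 0).
Proof.
split.
- exact: cmeasurable_cst.
- by exists 0 => x; rewrite normc0.
- by exists 0; split; rewrite ?num_real// => M _ x /=; rewrite eqxx.
- by move=> x /=; rewrite eqxx.
Qed.

Lemma CbcZ c f B : Cbc B f -> Cbc B (fun x => c * f x).
Proof.
move=> cf; have fc x : c * f x != 0 -> f x != 0.
  by apply: contra => /eqP ->; rewrite mulr0.
have [m [k fk] [r [rr fr]] fB] := cf; split.
- exact: cmeasurableZ.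
- by exists (normc c * k) => x; rewrite normcM ler_wpM2l// normc_ge0.
- by exists r; split=> // M rM x /fc fx; exact: fr fx.
- by move=> x /fc/fB.
Qed.

Lemma CbcD f g B : Cbc B f -> Cbc B g -> Cbc B (fun x => f x + g x).
Proof.
move=> cf cg; have [r r0 fr] := Cbc_box cf; have [s s0 gs] := Cbc_box cg.
have fg x : f x + g x != 0 -> f x != 0 \/ g x != 0.
  have [->|] := eqVneq (f x) 0; last by left.
  by rewrite add0r; right.
have [mf [k fk] _ fB] := cf; have [mg [l gl] _ gB] := cg; split.
- exact: cmeasurableD.
- by exists (k + l) => x; rewrite (le_trans (le_normcD _ _))// lerD.
- exists (r + s); split; first by rewrite num_real.
  move=> M rM x /fg[/fr|/gs] h; apply/ltW/(le_lt_trans h)/le_lt_trans/rM.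
    by rewrite lerDl ltW.
  by rewrite lerDr ltW.
- by move=> x /fg[/fB|/gB].
Qed.

Lemma CbcB f g B : Cbc B f -> Cbc B g -> Cbc B (fun x => f x - g x).
Proof.
move=> cf cg; under eq_fun do rewrite -[X in _ + X]mulN1r.
by apply: CbcD => //; exact: CbcZ.
Qed.

Lemma Cbc_translate x f B : Cbc B f -> Cbc setT (translate x f).
Proof.
move=> cf; have [r r0 fr] := Cbc_box cf.
have [[m1 m2] [k fk] _ _] := cf; have ms := measurable_shift_rV (- x); split.
- by split; [exact: (measurableT_comp m1 ms)|exact: (measurableT_comp m2 ms)].
- by exists k => y; exact: fk.
- exists (r + `|x|); split; first by rewrite num_real.
  move=> M rM y /fr h; apply/ltW/le_lt_trans/rM.
  by rewrite -[y](subrK x) (le_trans (ler_normD _ _))// lerD2r.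
- by [].
Qed.

Definition cube (r : R) : set 'rV[R]_d := [set x | forall i, - r <= x ord0 i <= r].

Lemma measurable_cube (r : R) : measurable (cube r).
Proof.
rewrite (_ : cube r = \big[setI/setT]_(i < d)
    ((fun y : 'rV[R]_d => y ord0 i : R) @^-1` `[- r, r]%classic)).
  apply: bigsetI_measurable => i _.
  by rewrite -[X in measurable X]setTI; exact: measurable_coord_rV.
rewrite -bigcap_seq; apply/seteqP; split => [y /= h i _ /=|y /= h i].
  by rewrite in_itv /=; exact: h.
by have := h i (mem_index_enum _); rewrite /= in_itv.
Qed.

Lemma lebesgue_rV_cube_lty (r : R) : (lebesgue_rV R d (cube r) < +oo)%E.
Proof.
have [r0|r0] := leP 0 r.
  have -> : cube r = [set x : 'rV[R]_d | forall i,
      (const_mx (- r) : 'rV_d) ord0 i <= x ord0 i <= (const_mx r : 'rV_d) ord0 i].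
    by apply/seteqP; split=> x h i; have := h i; rewrite !mxE.
  by rewrite lebesgue_rV_box ?ltry// => i; rewrite !mxE; lra.
(* For negative [r] the bounds of the box are in the wrong order; the cube is then compared with the
   degenerate [cube 0]. *)
apply: (@le_lt_trans _ _ (lebesgue_rV R d (cube 0))); last first.
  have -> : cube 0 = [set x : 'rV[R]_d | forall i,
      (const_mx 0 : 'rV_d) ord0 i <= x ord0 i <= (const_mx 0 : 'rV_d) ord0 i].
    by apply/seteqP; split=> x h i; have := h i; rewrite !mxE oppr0.
  by rewrite lebesgue_rV_box ?ltry.
rewrite le_measure ?inE//; [exact: measurable_cube|exact: measurable_cube|].
by move=> x xr i; have := xr i; lra.
Qed.

Lemma Cbc_cintegrable f B : Cbc B f -> cintegrable (lebesgue_rV R d) f.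
Proof.
move=> cf; have [r r0 fr] := Cbc_box cf; have [m [k fk] _ _] := cf.
apply: (cintegrable_bounded m (measurable_cube r) (lebesgue_rV_cube_lty r) fk) => x /= xr.
apply: contra_notP xr => /eqP/fr xr i.
by rewrite -ler_norml (le_trans (ler_coord_norm _ _)).
Qed.

Lemma CbcM f w B (k : R) : Cbc B f -> cmeasurable_fun w -> (forall x, normc (w x) <= k) ->
  Cbc B (fun x => w x * f x).
Proof.
move=> cf mw wk; have fc x : w x * f x != 0 -> f x != 0.
  by apply: contra => /eqP ->; rewrite mulr0.
have [m [l fl] [r [rr fr]] fB] := cf; split.
- exact: cmeasurableM.
- by exists (k * l) => x; rewrite normcM ler_pM// normc_ge0.
- by exists r; split=> // M rM x /fc fx; exact: fr fx.
- by move=> x /fc/fB.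
Qed.

Lemma cintegral_translate x f B : Cbc B f ->
  cintegral (lebesgue_rV R d) (translate x f) = cintegral (lebesgue_rV R d) f.
Proof.
move=> cf; have [f1 f2] := Cbc_cintegrable cf.
have [s1 s2] := Cbc_cintegrable (Cbc_translate x cf).
have [[m1 m2] _ _ _] := cf; have ms := measurable_shift_rV (- x).
have aux (h : 'rV[R]_d -> R) : measurable_fun setT h ->
    (lebesgue_rV R d).-integrable setT (fun y => (h (y - x))%:E) ->
    \int[lebesgue_rV R d]_y h (y - x) = \int[lebesgue_rV R d]_y h y.
  move=> mh ih; rewrite /Rintegral; congr fine.
  transitivity (\int[pushforward (lebesgue_rV R d) (fun y => y - x)%R]_y (h y)%:E)%E.
    rewrite integral_pushforward ?preimage_setT//; exact/measurable_EFinP.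
  by apply: eq_measure_integral => A mA _; exact: lebesgue_rV_shift.
by rewrite /cintegral; congr (_ +i* _); exact: aux.
Qed.

Lemma fourierE f u : fourier f u =
  cintegral (lebesgue_rV R d) (fun x => character u x * f x).
Proof.
rewrite /fourier; congr cintegral; apply/funext => x.
by rewrite /character /expi cosN sinN dotrC.
Qed.

Lemma Cbc_character u f B : Cbc B f -> Cbc B (fun x => character u x * f x).
Proof.
move=> cf; apply: (CbcM cf (cmeasurable_character u) (k := 1)) => x.
by rewrite normc_expi.
Qed.

Lemma fourierZ c f B u : Cbc B f -> fourier (fun x => c * f x) u = c * fourier f u.
Proof.
move=> cf; rewrite !fourierE.
rewrite -cintegralZ; last exact: (Cbc_cintegrable (Cbc_character u cf)).
by congr cintegral; apply/funext => x; rewrite mulrCA.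
Qed.

Lemma fourierD f g B u : Cbc B f -> Cbc B g ->
  fourier (fun x => f x + g x) u = fourier f u + fourier g u.
Proof.
move=> cf cg; rewrite !fourierE.
rewrite -cintegralD; [|exact: (Cbc_cintegrable (Cbc_character u cf))|
  exact: (Cbc_cintegrable (Cbc_character u cg))].
by congr cintegral; apply/funext => x; rewrite mulrDr.
Qed.

(** The phase at [y] is the phase at [x] times the phase at [y - x], and the integral is translation
    invariant. *)
Lemma fourier_translate x f B u : Cbc B f ->
  fourier (translate x f) u = character x u * fourier f u.
Proof.
move=> cf; have cfu := Cbc_character u cf; rewrite !fourierE.
have -> : character x u = character u x by rewrite /character dotrC.
rewrite -(cintegral_translate x cfu) -cintegralZ; last first.
  exact: (Cbc_cintegrable (Cbc_translate x cfu)).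
congr cintegral; apply/funext => y; rewrite /translate mulrA; congr (_ * _).
by rewrite /character -expiD -opprD -dotrDl subrKC.
Qed.

(** The kernel is jointly measurable; Tonelli's theorem is applied to the positive and negative
    parts of its real and imaginary parts. *)
Lemma fourier_measurable f B : Cbc B f -> cmeasurable_fun (fourier f).
Proof.
move=> cf; have [mf _ _ _] := cf.
have mk : cmeasurable_fun (fun p : 'rV[R]_d * 'rV[R]_d => character p.1 p.2 * f p.2).
  apply: cmeasurableM.
    apply: cmeasurable_expi; apply: measurableT_comp => //.
    exact: measurable_dotr.
  have [m1 m2] := mf.
  split; first exact: (measurableT_comp m1 measurable_snd).
  exact: (measurableT_comp m2 measurable_snd).
have aux (h : 'rV[R]_d * 'rV[R]_d -> R) : measurable_fun setT h ->
    measurable_fun setT (fun u => \int[lebesgue_rV R d]_x h (u, x)).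
  move=> mh; apply: (measurableT_comp (f := fine)) => //.
  under eq_fun do rewrite integralE.
  have mE : measurable_fun setT (EFin \o h) by exact/measurable_EFinP.
  have F (k : 'rV[R]_d * 'rV[R]_d -> \bar R) : measurable_fun setT k ->
      (forall p, (0 <= k p)%E) ->
      measurable_fun setT (fun u => (\int[lebesgue_rV R d]_x k (u, x))%E).
    by move=> mk0 k0; exact: measurable_fun_fubini_tonelli_F.
  apply: emeasurable_funB.
    have := F _ (measurable_funepos mE) (funepos_ge0 (EFin \o h)).
    congr (measurable_fun _ _); apply/funext => u; apply: eq_integral => x _.
    by rewrite !funeposE.
  have := F _ (measurable_funeneg mE) (funeneg_ge0 (EFin \o h)).
  congr (measurable_fun _ _); apply/funext => u; apply: eq_integral => x _.
  by rewrite !funenegE.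
have [mk1 mk2] := mk; split.
  by under eq_fun do rewrite fourierE; exact: (aux _ mk1).
by under eq_fun do rewrite fourierE; exact: (aux _ mk2).
Qed.

End Cbc_theory.

(** * Random measures *)

Section charge_integration.
Context {R : realType} {dT : measure_display} {T : measurableType dT}.
Implicit Types (g h : T -> R) (f : T -> R[i]).

Let bounded_measurable g := measurable_fun setT g /\ exists k : R, forall t, `|g t| <= k.

Let bounded_integrable (mu : {finite_measure set T -> \bar R}) g :
  bounded_measurable g -> mu.-integrable setT (EFin \o g).
Proof.
move=> [mg [k gk]]; apply: measurable_bounded_integrable => //.
  by rewrite -ge0_fin_numE//; exact: fin_num_measure.
by exists k; split; rewrite ?num_real// => l kl t _ /=; rewrite (le_trans (gk t))// ltW.
Qed.

Let bounded_measurableZ (a : R) g :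
  bounded_measurable g -> bounded_measurable (fun t => a * g t).
Proof.
move=> [mg [k gk]]; split; first exact: measurable_funM.
by exists (`|a| * k) => t; rewrite normrM ler_wpM2l.
Qed.

Let bounded_measurableD g h : bounded_measurable g -> bounded_measurable h ->
  bounded_measurable (fun t => g t + h t).
Proof.
move=> [mg [k gk]] [mh [l hl]]; split; first exact: measurable_funD.
by exists (k + l) => t; rewrite (le_trans (ler_normD _ _))// lerD.
Qed.

Let charge_integralD (nu : {charge set T -> \bar R}) g h :
  bounded_measurable g -> bounded_measurable h ->
  charge_integral nu (fun t => g t + h t) = charge_integral nu g + charge_integral nu h.
Proof.
move=> bg bh; rewrite /charge_integral !RintegralD//; try exact: bounded_integrable.
by ring.
Qed.

Let charge_integralZ (nu : {charge set T -> \bar R}) (a : R) g :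
  bounded_measurable g -> charge_integral nu (fun t => a * g t) = a * charge_integral nu g.
Proof.
move=> bg; rewrite /charge_integral !RintegralZl//; try exact: bounded_integrable.
by ring.
Qed.

(** Bounded functions are integrable against the finite Jordan parts, so each charge integral
    splits; the rest is complex arithmetic. *)
Lemma complex_measure_integral_lin (nu : complex_measure R T) (c : R[i]) f f' :
  cmeasurable_fun f -> (exists k, forall t, normc (f t) <= k) ->
  cmeasurable_fun f' -> (exists k, forall t, normc (f' t) <= k) ->
  complex_measure_integral nu (fun t => c * f t + f' t) =
  c * complex_measure_integral nu f + complex_measure_integral nu f'.
Proof.
case: c => a b [m1 m2] [k fk] [m1' m2'] [k' fk'].
have b1 : bounded_measurable (fun t => complex.Re (f t)).
  by split=> //; exists k => t; rewrite (le_trans (normr_Re_le _)).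
have b2 : bounded_measurable (fun t => complex.Im (f t)).
  by split=> //; exists k => t; rewrite (le_trans (normr_Im_le _)).
have b1' : bounded_measurable (fun t => complex.Re (f' t)).
  by split=> //; exists k' => t; rewrite (le_trans (normr_Re_le _)).
have b2' : bounded_measurable (fun t => complex.Im (f' t)).
  by split=> //; exists k' => t; rewrite (le_trans (normr_Im_le _)).
have ReE : (fun t => complex.Re ((a +i* b) * f t + f' t)) =
    fun t => (a * complex.Re (f t) + - b * complex.Im (f t)) + complex.Re (f' t).
  by apply/funext => t; case: (f t) => x y; case: (f' t) => x' y' /=; ring.
have ImE : (fun t => complex.Im ((a +i* b) * f t + f' t)) =
    fun t => (a * complex.Im (f t) + b * complex.Re (f t)) + complex.Im (f' t).
  by apply/funext => t; case: (f t) => x y; case: (f' t) => x' y' /=; ring.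
have E nu' : charge_integral nu' (fun t => complex.Re ((a +i* b) * f t + f' t)) =
    (a * charge_integral nu' (fun t => complex.Re (f t)) -
     b * charge_integral nu' (fun t => complex.Im (f t))) +
    charge_integral nu' (fun t => complex.Re (f' t)).
  rewrite ReE charge_integralD//; last first.
    by apply: bounded_measurableD; exact: bounded_measurableZ.
  rewrite charge_integralD ?charge_integralZ//; try exact: bounded_measurableZ.
  by rewrite mulNr.
have F nu' : charge_integral nu' (fun t => complex.Im ((a +i* b) * f t + f' t)) =
    (a * charge_integral nu' (fun t => complex.Im (f t)) +
     b * charge_integral nu' (fun t => complex.Re (f t))) +
    charge_integral nu' (fun t => complex.Im (f' t)).
  rewrite ImE charge_integralD//; last first.
    by apply: bounded_measurableD; exact: bounded_measurableZ.
  by rewrite charge_integralD ?charge_integralZ//; exact: bounded_measurableZ.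
rewrite /complex_measure_integral !E !F; apply/eqP; rewrite eq_complex /=.
by apply/andP; split; apply/eqP; ring.
Qed.

End charge_integration.

(** * Second moments and means *)

Section second_moment.
Context {R : realType} {dO : measure_display} {Omega : measurableType dO}.
Variable P : probability Omega R.
Implicit Types X Y : Omega -> R[i].

Lemma square_integrable_cintegrable X : square_integrable P X -> cintegrable P X.
Proof.
move=> [mX XL2]; have [m1 m2] := mX.
have mn : measurable_fun setT (fun w => (normc (X w) ^+ 2)%:E).
  exact/measurable_EFinP/measurable_sqr_normc.
have i2 : P.-integrable setT (fun w => (1 + normc (X w) ^+ 2)%:E).
  under eq_fun do rewrite EFinD.
  apply: integrableD => //; first exact: finite_measure_integrable_cst.
  apply/integrableP; split=> //.
  by under eq_integral do rewrite gee0_abs ?lee_fin ?sqr_ge0//.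
have le1 (x : R) (z : R[i]) : `|x| <= normc z -> `|x| <= 1 + normc z ^+ 2.
  by have := sqr_ge0 (normc z - 1); have := normc_ge0 z; rewrite sqrrB expr1n mulr1; lra.
split; apply: le_integrable i2 => //.
- exact/measurable_EFinP.
- move=> w _; rewrite /= lee_fin [leRHS]ger0_norm ?addr_ge0 ?sqr_ge0//.
  by apply: le1; exact: normr_Re_le.
- exact/measurable_EFinP.
- move=> w _; rewrite /= lee_fin [leRHS]ger0_norm ?addr_ge0 ?sqr_ge0//.
  by apply: le1; exact: normr_Im_le.
Qed.

(** Separates the variance, which the spectral measure describes, from the mean. The cross terms of
    [|X - m|^2] integrate to [- 2 |m|^2]. *)
Lemma second_momentE X : square_integrable P X ->
  (\int[P]_w (normc (X w) ^+ 2)%:E =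
   cvariance P X + (normc (cexpectation P X) ^+ 2)%:E)%E.
Proof.
move=> XL2; have [i1 i2] := square_integrable_cintegrable XL2.
have [mX Xoo] := XL2.
pose m := cexpectation P X.
have mn : measurable_fun setT (fun w => (normc (X w) ^+ 2)%:E).
  exact/measurable_EFinP/measurable_sqr_normc.
have iX : P.-integrable setT (fun w => (normc (X w) ^+ 2)%:E).
  apply/integrableP; split=> //.
  by under eq_integral do rewrite gee0_abs ?lee_fin ?sqr_ge0//.
have E1 w : normc (X w - m) ^+ 2 = normc (X w) ^+ 2 +
    ((- (2 * complex.Re m)) * complex.Re (X w) + (- (2 * complex.Im m)) * complex.Im (X w)
     + normc m ^+ 2).
  by rewrite !sqr_normcE !raddfB; ring.
have iZ (a : R) (h : Omega -> R) : P.-integrable setT (EFin \o h) ->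
    P.-integrable setT (EFin \o (fun w => a * h w)).
  by move=> ih; rewrite /comp; under eq_fun do rewrite EFinM; exact: integrableZl.
have iD (h k : Omega -> R) : P.-integrable setT (EFin \o h) -> P.-integrable setT (EFin \o k) ->
    P.-integrable setT (EFin \o (fun w => h w + k w)).
  by move=> ih ik; rewrite /comp; under eq_fun do rewrite EFinD; exact: integrableD.
have ic (a : R) : P.-integrable setT (EFin \o (fun _ : Omega => a)).
  exact: finite_measure_integrable_cst.
have fE (h : Omega -> R) : P.-integrable setT (EFin \o h) ->
    (\int[P]_w (h w)%:E = (\int[P]_w h w)%:E)%E.
  by move=> ih; rewrite /Rintegral fineK//; exact: integrable_fin_num.
have i12 := iD _ _ (iZ (- (2 * complex.Re m)) _ i1) (iZ (- (2 * complex.Im m)) _ i2).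
have i12c := iD _ _ i12 (ic (normc m ^+ 2)).
rewrite /cvariance -/m; under [in RHS]eq_integral do rewrite E1.
rewrite !fE//; last exact: iD.
rewrite -EFinD; congr (_%:E).
rewrite RintegralD// RintegralD// RintegralD//; [|exact: iZ|exact: iZ].
have P1 : fine (P setT) = 1 by rewrite probability_setT.
have Pc (a : R) : \int[P]_w a = a by rewrite Rintegral_cst// P1 mulr1.
rewrite !RintegralZl// Pc -/m sqr_normcE.
have -> : \int[P]_w complex.Re (X w) = complex.Re m by [].
have -> : \int[P]_w complex.Im (X w) = complex.Im m by [].
rewrite -[normc m * normc m]expr2 sqr_normcE; ring.
Qed.

Lemma cexpectation_ae X Y : cmeasurable_fun X -> cmeasurable_fun Y ->
  {ae P, forall w, X w = Y w} -> cexpectation P X = cexpectation P Y.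
Proof.
move=> [x1 x2] [y1 y2] XY; rewrite /cexpectation /cintegral /Rintegral.
congr (fine _ +i* fine _); apply: ae_eq_integral => //; try exact/measurable_EFinP.
  by apply: filterS XY => w -> _.
by apply: filterS XY => w -> _.
Qed.

End second_moment.

(** * Linearity of the random measure and combinations of translates *)

Section random_measure.
Context {R : realType} {d : nat} {dO : measure_display}.
Context {Omega : measurableType dO} (P : probability Omega R).
Variable M : ('rV[R]_d -> R[i]) -> Omega -> R[i].
Hypothesis M_stationary : weakly_stationary_random_measure P M.
Implicit Types (f g h : 'rV[R]_d -> R[i]).

(** Both supports lie in one closed ball [K], where almost surely the three values are integrals
    against the same complex measure. *)
Lemma random_measure_lin (c : R[i]) f g : Cbc setT f -> Cbc setT g ->
  {ae P, forall w, M (fun x => c * f x + g x) w = c * M f w + M g w}.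
Proof.
move=> cf cg; have [r r0 fr] := Cbc_box cf; have [s s0 gs] := Cbc_box cg.
pose K := [set x : 'rV[R]_d | `|x| <= r + s].
have cK : compact K.
  apply: bounded_closed_compact.
    exists (r + s); split; first by rewrite num_real.
    by move=> k rk x /= xr; apply/ltW/le_lt_trans/rk.
  apply: (@closed_comp _ _ (fun x : 'rV[R]_d => `|x|) [set t | t <= r + s]) => [x _|].
    exact: norm_continuous.
  exact: closed_le.
have Kf : Cbc K f.
  by apply: Cbc_subset => // x /fr h; rewrite /K /= (le_trans h)// lerDl ltW.
have Kg : Cbc K g.
  by apply: Cbc_subset => // x /gs h; rewrite /K /= (le_trans h)// lerDr ltW.
have Kfg : Cbc K (fun x => c * f x + g x) by apply: CbcD => //; exact: CbcZ.
have [mu muE] := wsrm_measure M_stationary cK.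
apply: filterS3 (muE _ Kf) (muE _ Kg) (muE _ Kfg) => w -> -> ->.
have [mf bf _ _] := cf; have [mg bg _ _] := cg.
exact: complex_measure_integral_lin.
Qed.

Lemma random_measure_mean_lin (c : R[i]) f g : Cbc setT f -> Cbc setT g ->
  cexpectation P (M (fun x => c * f x + g x)) =
  c * cexpectation P (M f) + cexpectation P (M g).
Proof.
move=> cf cg.
have L2f := wsrm_L2 M_stationary cf; have L2g := wsrm_L2 M_stationary cg.
have cfg : Cbc setT (fun x => c * f x + g x) by apply: CbcD => //; exact: CbcZ.
have [mfg _] := wsrm_L2 M_stationary cfg; have [mf _] := L2f; have [mg _] := L2g.
rewrite (cexpectation_ae mfg _ (random_measure_lin c cf cg)); last first.
  by apply: cmeasurableD => //; exact: cmeasurableZ.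
rewrite /cexpectation cintegralD ?cintegralZ//; try exact: square_integrable_cintegrable.
by apply: cintegrableZ; exact: square_integrable_cintegrable.
Qed.

Lemma random_measure_mean0 : cexpectation P (M (fun=> 0)) = 0.
Proof.
have := random_measure_mean_lin 1 (@Cbc0 R d setT) (@Cbc0 R d setT).
under [in LHS]eq_fun do rewrite mulr0 addr0.
rewrite mul1r => /eqP; rewrite -subr_eq0 opprD addNKr oppr_eq0 => /eqP //.
Qed.

(** Almost sure linearity replaces [M h - M f] by [M (h - f)], to which [second_momentE] applies. *)
Lemma random_measure_dist f h : Cbc setT f -> Cbc setT h ->
  (\int[P]_w (normc (M h w - M f w) ^+ 2)%:E =
   cvariance P (M (fun x => h x - f x)%R) +
   (normc (cexpectation P (M h) - cexpectation P (M f)) ^+ 2)%:E)%E.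
Proof.
move=> cf ch; have cfh : Cbc setT (fun x => h x - f x) by exact: CbcB.
have L2fh := wsrm_L2 M_stationary cfh; have [mfh _] := L2fh.
have [mf _] := wsrm_L2 M_stationary cf; have [mh _] := wsrm_L2 M_stationary ch.
have E : (fun x => h x - f x) = (fun x => -1 * f x + h x).
  by apply/funext => x; rewrite mulN1r addrC.
have -> : cexpectation P (M h) - cexpectation P (M f) =
    cexpectation P (M (fun x => h x - f x)).
  by rewrite E random_measure_mean_lin// mulN1r addrC.
rewrite -second_momentE//; apply: ge0_ae_eq_integral => //.
- exact/measurable_EFinP/measurable_sqr_normc/cmeasurableB.
- exact/measurable_EFinP/measurable_sqr_normc.
- by move=> w _; rewrite lee_fin sqr_ge0.
- by move=> w _; rewrite lee_fin sqr_ge0.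
- rewrite E; apply: filterS (random_measure_lin (-1) cf ch) => w -> _.
  by rewrite mulN1r (addrC (- _)).
Qed.

(** The witness combines translates of [f] with the coefficients of [p]. The mean is translation
    invariant, so it is multiplied by the sum of these coefficients, which is [p 0]. *)
Lemma trig_realized (N B : set 'rV[R]_d) f p : Cbc setT f ->
  (forall x, N x -> Cbc B (translate x f)) -> trig N p ->
  exists h, [/\ Cbc B h, forall u, fourier h u = p u * fourier f u &
    cexpectation P (M h) = p 0 * cexpectation P (M f)].
Proof.
move=> cf NB; elim=> [|c x q Nx _ [h [ch hq hm]]].
  exists (fun=> 0); split; first exact: Cbc0.
    move=> u; rewrite -(fourierZ 0 u cf); congr fourier.
    by apply/funext => x; rewrite mul0r.
  by rewrite mul0r random_measure_mean0.
have ct := NB _ Nx.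
exists (fun y => c * translate x f y + h y); split.
- by apply: CbcD => //; exact: CbcZ.
- move=> u; rewrite (fourierD u (CbcZ c ct) ch) (fourierZ _ _ ct).
  by rewrite (fourier_translate _ _ cf) hq; ring.
- rewrite random_measure_mean_lin; [|exact: CbcW ct|exact: CbcW ch].
  rewrite (wsrm_mean M_stationary x cf) hm /character dotr0l oppr0 expi0; ring.
Qed.

End random_measure.

(** * Rigidity from the spectral gap *)

Section maximal_rigidity.
Context {R : realType} {d : nat}.
Implicit Types (u x : 'rV[R]_d) (f : 'rV[R]_d -> R[i]).

Lemma fourierB f g B u : Cbc B f -> Cbc B g ->
  fourier (fun x => f x - g x) u = fourier f u - fourier g u.
Proof.
move=> cf cg; under [in LHS]eq_fun do rewrite -[X in _ + X]mulN1r.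
by rewrite (fourierD u cf (CbcZ (-1) cg)) (fourierZ _ _ cg) mulN1r.
Qed.

(** For a function supported in the ball of radius [k], a translation by [x] with [a_i.x <= - r]
    moves the support out of the half-space [a_i.y >= 0]. *)
Lemma dotr_bounded (a : 'I_d -> 'rV[R]_d) (k : R) : 0 < k ->
  exists2 r : R, 0 < r & forall x, `|x| <= k -> forall i, dotr (a i) x < r.
Proof.
move=> k0; pose A i := \sum_j `|a i ord0 j| * k.
have A0 i : 0 <= A i by apply: sumr_ge0 => j _; rewrite mulr_ge0// ltW.
exists (1 + \sum_i A i) => [|x xk i]; first by rewrite ltr_wpDr// sumr_ge0.
apply: (@le_lt_trans _ _ (A i)).
  apply: ler_sum => j _; rewrite (le_trans (ler_norm _))// normrM ler_wpM2l//.
  exact: le_trans (ler_coord_norm x j) xk.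
by rewrite (bigD1 i)//= addrCA ltrDl ltr_pwDl// sumr_ge0.
Qed.

(* [d > 0] leaves room in an open set to avoid the origin, where the mean of [M] sits. *)
Lemma open_dual_box (a b : 'I_d -> 'rV[R]_d) (O : set 'rV[R]_d) : (0 < d)%N ->
  (forall w, w = \sum_i dotr (b i) w *: a i) -> open O -> O !=set0 ->
  exists u0, exists2 e : R, 0 < e & forall u, u = 0 \/ ~ O u ->
    exists i, e < `|dotr (b i) (u - u0)|.
Proof.
move=> d0 abE oO [y Oy].
have [u0 Ou0 u00] : exists2 u0, O u0 & u0 != 0.
  have [y0|y0] := eqVneq y 0; last by exists y.
  have := oO; rewrite openE => /(_ _ Oy)/nbhs_ballP[t /= t0 tO].
  exists (const_mx (t / 2)).
    apply: tO; rewrite -ball_normE /= y0 sub0r normrN.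
    apply: (@le_lt_trans _ _ (t / 2)); last by rewrite ltr_pdivrMr// ltr_pMr// ltr1n.
    apply: norm_rV_le => [|i]; first by rewrite divr_ge0 ?ltW.
    by rewrite mxE ger0_norm// divr_ge0 ?ltW.
  apply/eqP => /rowP/(_ (Ordinal d0)); rewrite !mxE => /eqP.
  by rewrite mulf_eq0 invr_eq0 pnatr_eq0 orbF gt_eqF.
have := oO; rewrite openE => /(_ _ Ou0)/nbhs_ballP[t /= t0 tO].
(* The bound [t] keeps the box inside [O], and [|u0|] keeps it away from the origin. *)
pose s := Num.min t `|u0|.
have s0 : 0 < s by rewrite lt_min t0 normr_gt0.
(* [A] controls the passage from the coordinates [b_i.w] to the norm of [w], through the expansion
   of [w] in the basis [a]. *)
pose A := 1 + \sum_i `|a i|.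
have A0 : 0 < A by rewrite ltr_wpDr// sumr_ge0.
exists u0, (s / 2 / A) => [|u uO]; first by rewrite !divr_gt0.
apply: contrapT => nbox.
have box i : `|dotr (b i) (u - u0)| <= s / 2 / A.
  by rewrite leNgt; apply/negP => h; apply: nbox; exists i.
have us : `|u - u0| < s.
  apply: (@le_lt_trans _ _ (s / 2)); last by rewrite ltr_pdivrMr// ltr_pMr// ltr1n.
  rewrite [u - u0]abE (le_trans (ler_norm_sum _ _ _))//.
  apply: (@le_trans _ _ (\sum_i s / 2 / A * `|a i|)).
    by apply: ler_sum => i _; rewrite normrZ ler_wpM2r.
  rewrite -mulr_sumr -[leRHS](divfK (lt0r_neq0 A0)) ler_wpM2l ?lerDr//.
  by rewrite ltW// !divr_gt0.
case: uO => [u0E|]; last first.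
  apply; apply: tO; rewrite -ball_normE /= distrC (lt_le_trans us)//.
  by rewrite ge_min lexx.
by move: us; rewrite u0E sub0r normrN lt_min ltxx andbF.
Qed.

Context {dO : measure_display} {Omega : measurableType dO} (P : probability Omega R).
Variable M : ('rV[R]_d -> R[i]) -> Omega -> R[i].
Hypothesis M_stationary : weakly_stationary_random_measure P M.
Variable S : {measure set 'rV[R]_d -> \bar R}.
Hypothesis SM : spectral_measure P M S.

(** Density against [S] for which a test function with transform [p fhat] has variance equal to the
    squared norm of [p]. *)
Definition spectral_weight f u : R := (2 * pi) ^- d * normc (fourier f u) ^+ 2.

Lemma spectral_weight_ge0 f u : 0 <= spectral_weight f u.
Proof. by rewrite mulr_ge0 ?sqr_ge0// invr_ge0 exprn_ge0// mulr_ge0// pi_ge0. Qed.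

Lemma measurable_spectral_weight f B : Cbc B f -> measurable_fun setT (spectral_weight f).
Proof.
move=> cf; apply: measurable_funM => //; apply: measurable_sqr_normc.
exact: fourier_measurable cf.
Qed.

Lemma cvariance_wL2 f g p : Cbc setT f -> Cbc setT g ->
  (forall u, fourier g u = p u * fourier f u) ->
  cvariance P (M g) = wL2 S (spectral_weight f) p.
Proof.
move=> cf cg gp; rewrite (spectral_variance SM cg) -ge0_integralZl//.
- apply: eq_integral => u _; rewrite gp /spectral_weight normcM -EFinM; congr (_%:E).
  by ring.
- exact/measurable_EFinP/measurable_sqr_normc/(fourier_measurable cg).
- by move=> u _; rewrite lee_fin sqr_ge0.
- by rewrite lee_fin invr_ge0 exprn_ge0// mulr_ge0// pi_ge0.
Qed.

(** The total mass is the variance of [M f], at most its second moment. *)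
Lemma spectral_weight_integrable f : Cbc setT f ->
  (\int[S]_u (spectral_weight f u)%:E < +oo)%E.
Proof.
move=> cf; have L2f := wsrm_L2 M_stationary cf; have [_] := L2f.
rewrite second_momentE// (@cvariance_wL2 _ _ (fun=> 1) cf cf); last first.
  by move=> u; rewrite mul1r.
rewrite /wL2; under eq_integral do rewrite normc1 expr1n mul1r.
by apply: le_lt_trans; rewrite leeDl// lee_fin sqr_ge0.
Qed.

(** Two approximations are chained: [W n] approximates one off the box, and a trigonometric
    polynomial [p] with the same admissible frequencies approximates [W n]; translates of [f] then
    realise [p]. *)
Lemma rigidity_step (B O : set 'rV[R]_d) f (eta : R) : (0 < d)%N ->
  closed_strictly_convex_cone B -> open O -> O !=set0 -> S O = 0%E -> Cbc B f -> 0 < eta ->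
  exists2 h, Cbc (~` B) h & (\int[P]_w (normc (M h w - M f w) ^+ 2)%:E <= eta%:E)%E.
Proof.
move=> d0 cone oO O0 SO cBf eta0; have cf : Cbc setT f by exact: CbcW cBf.
have [a [b [aB dual abE]]] := dual_bases cone.
have [k k0 fk] := Cbc_box cf.
have [r r0 ar] := dotr_bounded a k0.
have [u0 [e e0 boxO]] := open_dual_box d0 abE oO O0.
have [W [C [NW WC W1]]] := box_approx_one u0 e0 r0 dual.
set N := [set x | _] in NW.
(* A point [y] of [B] has [a_i.y >= 0]; but [y - x] in the support of [f] gives
   [a_i.y < r - r = 0]. *)
have NB x : N x -> Cbc (~` B) (translate x f).
  move=> [i ax]; apply: Cbc_subset (Cbc_translate x cf) _ => y fy By.
  have := aB i y By; rewrite -[y](subrK x) dotrDr.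
  by have := ar _ (fk _ fy) i; lra.
pose g := spectral_weight f; have g0 := spectral_weight_ge0 f.
have mg := measurable_spectral_weight cf; have ig := spectral_weight_integrable cf.
pose m := cexpectation P (M f).
pose D := 1 + normc m ^+ 2.
have D0 : 0 < D by rewrite ltr_wpDr// sqr_ge0.
(* Two errors below [c] combine to at most [4 c], for the variance and at the origin alike, and
   [4 c D = eta] covers both contributions. *)
pose c := eta / D / 4; have c0 : 0 < c by rewrite !divr_gt0.
have mW n : cmeasurable_fun (W n) := bclosure_measurable (NW n).
have mW1 n : cmeasurable_fun (fun u => 1 - W n u).
  by apply: cmeasurableB => //; exact: cmeasurable_cst.
have [n [Wn Wn0]] : exists n, (wL2 S g (fun u => 1 - W n u)%R < c%:E)%E /\
    normc (1 - W n 0) ^+ 2 < c.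
  have l1 : (fun n => wL2 S g (fun u => 1 - W n u)%R) @ \oo --> 0%E.
    apply: (@wL2_dominated _ _ _ S g g0 mg ig _ (1 + C) O) => //.
    - exact: open_measurable_rV.
    - move=> n u Ou; rewrite (le_trans (le_normcD _ _))// normc1 normcN lerD2l.
      by apply/WC/boxO; right.
    - move=> u Ou; rewrite /ccvg; under eq_fun do rewrite subr0 normcB_sym.
      by apply/W1/boxO; right.
  have l2 : (fun n => normc (1 - W n 0) ^+ 2) @ \oo --> (0 : R).
    rewrite -(mulr0 (0 : R)); under eq_fun do rewrite expr2 normcB_sym.
    (* The box avoids the origin, so [W n 0] tends to one as well; this controls the mean. *)
    by apply: cvgM; apply/W1/boxO; left.
  have : \forall n \near \oo, (wL2 S g (fun u => 1 - W n u)%R < c%:E)%E /\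
      normc (1 - W n 0) ^+ 2 < c.
    apply: filterI.
      by apply: (l1 [set y | (y < c%:E)%E]); apply: open_ereal_lt'; rewrite lte_fin.
    have /cvgr_dist_lt/(_ _ c0) := l2; apply: filterS => n.
    by rewrite sub0r normrN ger0_norm// sqr_ge0.
  by case=> n _ /(_ n (leqnn n)); exists n.
have [p [tp Wp Wp0]] := bclosure_wL2_trig g0 mg ig 0 (NW n) c0.
have mp : cmeasurable_fun p := bclosure_measurable (trig_bclosure tp).
have [h [ch hp hm]] := trig_realized M_stationary cf NB tp.
have ch' : Cbc setT h by exact: CbcW ch.
exists h => //.
rewrite (random_measure_dist M_stationary cf ch') hm -/m.
rewrite (@cvariance_wL2 f _ (fun u => -1 * (1 - p u)) cf (CbcB ch' cf)); last first.
  by move=> u; rewrite (fourierB u ch' cf) hp; ring.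
have m1p : cmeasurable_fun (fun u => 1 - p u).
  by apply: cmeasurableB => //; exact: cmeasurable_cst.
rewrite wL2Z// normcN normc1 expr1n mul1e.
have -> : p 0 * m - m = - ((1 - p 0) * m) by ring.
rewrite normcN normcM exprMn.
have p0c : normc (1 - p 0) ^+ 2 <= 4 * c.
  rewrite -(subrKA (W n 0)) (le_trans (sqr_normcD_le _ _))//; lra.
have pc : (wL2 S g (fun u => 1 - p u)%R <= (4 * c)%:E)%E.
  under [X in wL2 _ _ X]eq_fun => u do rewrite -(subrKA (W n u)).
  apply: le_trans (wL2D S g0 mg (mW1 n) (cmeasurableB (mW n) mp)) _.
  move: Wn Wp (wL2_ge0 S g0 (fun u => 1 - W n u)%R) (wL2_ge0 S g0 (fun u => W n u - p u)%R).
  case: (wL2 S g _) => [y1||]//; case: (wL2 S g _) => [y2||]//.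
  rewrite -!EFinM -EFinD !lte_fin !lee_fin => y1c y2c _ _; lra.
apply: (@le_trans _ _ ((4 * c)%:E + (4 * c * normc m ^+ 2)%:E)%E).
  by rewrite leeD// lee_fin ler_wpM2r// sqr_ge0.
rewrite -EFinD lee_fin le_eqVlt; apply/orP; left; apply/eqP.
by rewrite -[X in X + _]mulr1 -mulrDr -/D /c; field; rewrite gt_eqF.
Qed.

End maximal_rigidity.

Theorem theorem4 (R : realType) (d : nat) (hd : (0 < d)%N)
  (dO : measure_display) (Omega : measurableType dO) (P : probability Omega R)
  (M : ('rV[R]_d -> R[i]) -> Omega -> R[i])
  (M_stationary : weakly_stationary_random_measure P M)
  (M_stealthy : stealthy P M)
  (B : set 'rV[R]_d) (B_cone : closed_strictly_convex_cone B) :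
  linearly_maximally_rigid P M B.
Proof.
move=> f cf; have [S [SM [U [oU U0 SU]]]] := M_stealthy.
have hE (n : nat) : exists h, Cbc (~` B) h /\
    (\int[P]_w (normc (M h w - M f w) ^+ 2)%:E <= (harmonic n)%:E)%E.
  have [h ch hn] := rigidity_step M_stationary SM hd B_cone oU U0 SU cf (harmonic_gt0 n).
  by exists h.
have [h hP] := choice hE.
exists h; split=> [n|]; first by have [] := hP n.
apply: (@squeeze_cvge _ _ _ _ (fun=> 0%E) _ (EFin \o harmonic)).
- near=> n; have [_ ->] := hP n; rewrite andbT.
  by apply: integral_ge0 => w _; rewrite lee_fin sqr_ge0.
- exact: cvg_cst.
- exact: cvge_harmonic.
Unshelve. all: by end_near. Qed.
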